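(* Let $X=\{X_t\}_{t\ge0}$ be a Lévy process, $r\ge0$, and $M=\sup\{X_t\colon 0\le t\le e(r)\}$, where $M$ is a proper (a.s. finite) random variable with $\mathbf{P}_x(M>x)>0$. Let $n\ge1$ and let $p_n$ be a real polynomial of degree $n$ with leading coefficient $a_n=1$ and $p_n(0)=0$. Assume that the first $n$ moments of $M$ under $\mathbf{P}_0$ are finite. Define $$g(x)=\left(p_n(x^+)\right)^+,\quad x\in\mathbb{R}.$$ Let $P_n$ be the averaging polynomial of $p_n$ for the random variable $M$, and let $x^*$ be the largest positive root of $P_n$. Define $$G(x)=P_n(x)\mathbf{1}_{\{x\ge x^*\}},\qquad V(x)=\mathbf{E}_x\,G(M),\qquad \tau^*=\inf\{t\ge0\colon X_t\ge x^*\}.$$ If $G$ is non-decreasing and $V(x)\ge g(x)$ for all $x\le x^*$, then the pair $(V,\tau^* )$ is a solution of the optimal stopping problem, i.e. for every $x\in\mathbb{R}$ $$V(x)=\sup_{\tau\in\mathcal{M}}\mathbf{E}_x\,e^{-r\tau}g(X_\tau)=\mathbf{E}_x\,e^{-r\tau^*}g(X_{\tau^*}).$$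
   Context: $X=\{X_t\}_{t\ge0}$ is a real-valued Lévy process (càdlàg paths, independent and stationary increments) defined on a stochastic basis $(\Omega,\mathcal{F},\mathbf{F}=(\mathcal{F}_t)_{t\ge0},\mathbf{P}_x)$ (filtered probability space satisfying the usual conditions, $X$ being a Lévy process with respect to $\mathbf{F}$). Under $\mathbf{P}_x$ the process starts from $X_0=x$; $\mathbf{E}_x$ denotes expectation under $\mathbf{P}_x$, and the law of $X$ under $\mathbf{P}_x$ is the law of $x+X$ under $\mathbf{P}_0$. For $r>0$, $e(r)$ is an exponential random variable with parameter $r$, independent of $X$; for $r=0$, $e(0)=\infty$, so that $M=\sup_{t\ge0}X_t$. That $M$ is proper means that either $r>0$, or $r=0$ and $X$ drifts to $-\infty$; the condition $\mathbf{P}_x(M>x)>0$ excludes the case where $X$ is the negative of a subordinator. $\mathcal{M}$ is the set of all stopping times $\tau\colon\Omega\to[0,\infty]$, i.e. $\{\tau\le t\}\in\mathcal{F}_t$ for all $t\ge0$; the value $\tau=\infty$ is allowed. On $\{\tau=\infty\}$ the payoff $e^{-r\tau}g(X_\tau)$ is understood as $\limsup_{t\to\infty}e^{-rt}g(X_t)$. The convention $\inf\emptyset=\infty$ is used, and $y^+=\max(y,0)$. Averaging polynomial: write $p_n(x)=x^n+a_{n-1}x^{n-1}+\cdots+a_1x$, with $a_n=1$, $a_0=0$, and $\mu_k=\mathbf{E}_0(M^k)$ for $k=1,\dots,n$, $\mu_0=1$. The averaging polynomial of $p_n$ for $M$ is the polynomial $P_n(x)=x^n+b_{n-1}x^{n-1}+\cdots+b_1x+b_0$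 satisfying $\mathbf{E}_x P_n(M)=p_n(x)$ for all $x\in\mathbb{R}$. Its coefficients are determined by $b_n=1$ and the backward recursion $b_\ell=a_\ell-\sum_{k=\ell+1}^n b_k\binom{k}{\ell}\mu_{k-\ell}$ for $\ell=n-1,\dots,0$. The polynomial $P_n$ always has at least one positive root, so $x^*$ is well defined. *)

(* Defs.v *)
From HB Require Import structures.
From mathcomp Require Import all_boot all_order all_algebra.
From mathcomp Require Import all_classical all_reals all_analysis.
From mathcomp Require Import measurable_realfun.
Set Implicit Arguments.
Unset Strict Implicit.
Unset Printing Implicit Defensive.
Import Order.TTheory GRing.Theory Num.Theory.
Import numFieldNormedType.Exports.
Local Open Scope classical_set_scope.
Local Open Scope ring_scope.

(* Time is a real number; only the values of processes, filtrations and paths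
   at times t >= 0 are relevant. *)

Section paths.
Context {R : realType}.

Definition cadlag (f : R -> R) : Prop :=
  (forall t, 0 <= t -> f s @[s --> t^'+] --> f t) /\
  (forall t, 0 < t -> exists l : R, f s @[s --> t^'-] --> l).

(* The sigma-algebra on the path space generated by the coordinate maps. *)
Definition path_events : set (set (R -> R)) :=
  <<s [set A | exists t, exists B : set R,
        [/\ 0 <= t, measurable B & A = [set f | B (f t)]]] >>.

End paths.

Section processes.
Context {R : realType} {d : measure_display} {T : measurableType d}.
Implicit Types (P : R -> probability T R) (F : R -> set (set T)).
Implicit Types (X : R -> T -> R) (e tau : T -> \bar R) (g : R -> R).

(* The usual conditions for a family of probability measures P x on the same
   space.  Completeness refers to the sets that are negligible under every P x:
   asking that the sets negligible under a single P x belong to F 0 would be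
   contradictory, because the P x are mutually singular (X 0 = x, P x-a.s.). *)
Record usual_filtration P F : Prop := {
  filtration_sigma_algebra : forall t, 0 <= t -> sigma_algebra setT (F t);
  filtration_sub : forall t, 0 <= t -> F t `<=` measurable;
  filtration_mono : forall s t, 0 <= s -> s <= t -> F s `<=` F t;
  filtration_right_continuous : forall t, 0 <= t ->
    \bigcap_(s in [set s | t < s]) F s `<=` F t;
  filtration_complete : forall N : set T,
    (forall x, (P x).-negligible N) -> F 0 N }.

Record levy_process (Q : probability T R) F X : Prop := {
  levy_cadlag : forall w, cadlag (X ^~ w);
  levy_adapted : forall t (B : set R), 0 <= t -> measurable B ->
    F t (X t @^-1` B);
  levy_independent_increments : forall s t (A : set T) (B : set R),
    0 <= s -> s <= t -> F s A -> measurable B ->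
    Q (A `&` [set w | B (X t w - X s w)]) =
      (Q A * Q [set w | B (X t w - X s w)%R])%E;
  levy_stationary_increments : forall s t (B : set R),
    0 <= s -> s <= t -> measurable B ->
    Q [set w | B (X t w - X s w)] = Q [set w | B (X (t - s) w - X 0 w)] }.

Record levy_family P F X : Prop := {
  family_usual : usual_filtration P F;
  family_levy : forall x, levy_process (P x) F X;
  family_start : forall x, {ae P x, forall w, X 0 w = x};
  family_law : forall x (A : set (R -> R)), path_events A ->
    P x [set w | A (fun t => X t w)] = P 0 [set w | A (fun t => x + X t w)] }.

(* An exponential time of rate r, read as +oo when r = 0, independent of X. *)
Record killing_time P X (r : R) e : Prop := {
  killing_measurable : measurable_fun setT e;
  killing_exponential : 0 < r -> forall x (B : set R), measurable B ->
    P x (e @^-1` (EFin @` B)) = exponential_prob r B;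
  killing_infinite : r = 0 -> forall w, e w = +oo%E;
  killing_independent : forall x (A : set (R -> R)) (B : set (\bar R)),
    path_events A -> measurable B ->
    P x ([set w | A (fun t => X t w)] `&` e @^-1` B) =
      (P x [set w | A (fun t => X t w)] * P x (e @^-1` B))%E }.

Definition sup_until X e (w : T) : \bar R :=
  ereal_sup [set (X t w)%:E | t in [set t | 0 <= t /\ (t%:E <= e w)%E]].

Definition stopping_time F tau : Prop :=
  (forall w, (0 <= tau w)%E) /\
  (forall t, 0 <= t -> F t [set w | (tau w <= t%:E)%E]).

(* The default branch is tau w = +oo, because stopping times are nonnegative. *)
Definition discounted_payoff (r : R) g X tau (w : T) : \bar R :=
  match tau w with
  | t%:E => (expR (- r * t) * g (X t w))%:E
  | _ => limf_esup (fun t => (expR (- r * t) * g (X t w))%:E) +oo%R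
  end.

Definition hitting_time X (a : R) (w : T) : \bar R :=
  ereal_inf [set t%:E | t in [set t | 0 <= t /\ a <= X t w]].

(* Q is the averaging polynomial, for the random variable M, of a polynomial p
   of degree n.  M may take infinite values on a null set only, hence fine. *)
Definition averaging_poly P (M : T -> \bar R) (n : nat) (p Q : {poly R}) :=
  [/\ Q \is monic, size Q = n.+1 &
      forall x, 'E_(P x)[fun w => Q.[fine (M w)]]%E = (p.[x])%:E].

End processes.

Section functions.
Context {R : realType}.

Definition pos_part (y : R) : R := Num.max y 0.

Definition poly_payoff (p : {poly R}) (x : R) : R := pos_part p.[pos_part x].

Definition largest_positive_root (Q : {poly R}) (a : R) : Prop :=
  [/\ 0 < a, root Q a & forall y, 0 < y -> root Q y -> y <= a].

Definition truncated_poly (Q : {poly R}) (a : R) (x : R) : R :=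
  Q.[x] * \1_[set y | a <= y] x.

End functions.

(* Main.v *)
(* By the memoryless property of the exponential law and the independence of
   increments, for a stopping time tau and V x = E_x H(M),
     E_x e^{-r tau} V(X_tau) = E_x (H(sup of X over [tau, e]); tau <= e),
   with e replaced by a copy independent of the filtration.  With H = G monotone
   the right-hand side is at most E_x G(M) = V x, and g <= V gives the upper
   bound.  For tau = tau*, the level xs must be reached before M can exceed it,
   so G(M) vanishes unless tau* <= e, and V = p_n = g on [xs, oo): equality holds.
   For dyadic approximations of tau from above the identity is the simple Markov
   property; one passes to the limit by dominated convergence for the payoffs and
   by Fatou's lemma for the suprema, the bound being the integral over the law of
   e of h(sup of X over [0, e]), for a monotone h dominating g.  When r = 0,
   finiteness of M forces X to be eventually nonpositive, so the payoff at infinity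
   is zero. *)

Require Import Defs.
From HB Require Import structures.
From mathcomp Require Import all_boot all_order all_algebra.
From mathcomp Require Import all_classical all_reals all_analysis.
From mathcomp Require Import measurable_realfun.
From mathcomp Require Import ring lra.
Set Implicit Arguments.
Unset Strict Implicit.
Unset Printing Implicit Defensive.
Import Order.TTheory GRing.Theory Num.Theory.
Import numFieldNormedType.Exports.
Local Open Scope classical_set_scope.
Local Open Scope ring_scope.

(** Two obstacles shape the proof. First, that [tau*] is a stopping time is not immediate: a path
    may come arbitrarily close to [xs] from the left and jump down without reaching it, and
    countably many times cannot tell this from a hit. Such paths are shown to be null under every
    [P x], so completeness places them in [F 0]. Second, the dyadic times lie strictly after [tau*],
    where X may already have slipped below [xs] and V may exceed g. A sample is therefore kept only
    when X is at least [xs - eta]; there V is at most [g + eps], by continuity of [Pn] at its root.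
    Right-continuity ensures that no sample is lost in the limit. The majorant is
    [h y = c * (1 + y^+)^n], with c the sum of the absolute values of the coefficients of p. The
    n-th moment of M makes its expectation finite from every starting point. *)

Lemma invS_lt (R : realType) (e : R) : 0 < e -> exists n : nat, n.+1%:R^-1 < e.
Proof.
move=> e0; exists (Num.truncn e^-1).
by rewrite invf_plt ?posrE ?ltr0n// Num.Theory.truncnS_gt.
Qed.

(** * Running suprema *)

Section running_sup.
Context {R : realType}.
Implicit Types (f : R -> R) (u : \bar R) (t e a : R).

Definition running_sup f u : \bar R :=
  ereal_sup [set (f s)%:E | s in [set s | 0 <= s /\ (s%:E <= u)%E]].

Definition right_continuous f : Prop :=
  forall t, 0 <= t -> f s @[s --> t^'+] --> f t.

Lemma running_sup_gtP f u (a : R) :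
  (a%:E < running_sup f u)%E <-> exists s, [/\ 0 <= s, (s%:E <= u)%E & a < f s].
Proof.
split.
  by case/ereal_sup_gt => _ [s [s0 su] <-]; rewrite lte_fin => afs; exists s.
case=> s [s0 su afs]; apply: (@lt_le_trans _ _ (f s)%:E); first by rewrite lte_fin.
by apply: ereal_sup_ubound; exists s.
Qed.

Lemma running_sup_ge f u s : 0 <= s -> (s%:E <= u)%E ->
  ((f s)%:E <= running_sup f u)%E.
Proof. by move=> s0 su; apply: ereal_sup_ubound; exists s. Qed.

Lemma le_running_sup f u v : (u <= v)%E -> (running_sup f u <= running_sup f v)%E.
Proof.
move=> uv; apply: ereal_sup_le => _ [s [s0 su] <-].
by exists s => //; split=> //; exact: le_trans uv.
Qed.

Lemma right_continuous_dist f t e : right_continuous f -> 0 <= t -> 0 < e ->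
  exists2 d, 0 < d & forall s, t <= s -> s < t + d -> `|f t - f s| < e.
Proof.
move=> rf t0 e0; have /cvgrPdist_lt/(_ e e0) := rf t t0.
rewrite nbhs_right0P => -[/= d d0 dP]; exists d => // s.
rewrite le_eqVlt => /orP[/eqP <- _|ts std]; first by rewrite subrr normr0.
have := dP (s - t); rewrite /ball_ /= sub0r normrN ger0_norm ?subr_ge0 1?ltW// subr_gt0.
by rewrite [t + _]addrC subrK; apply => //; lra.
Qed.

Lemma right_continuous_gt f t a : right_continuous f -> 0 <= t -> a < f t ->
  exists2 d, 0 < d & forall s, t <= s -> s < t + d -> a < f s.
Proof.
move=> rf t0 aft.
have [|d d0 dP] := @right_continuous_dist f t (f t - a) rf t0; first by rewrite subr_gt0.
exists d => // s ts std; have := dP s ts std.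
by rewrite ltr_norml; lra.
Qed.

Lemma right_continuous_lt f t a : right_continuous f -> 0 <= t -> f t < a ->
  exists2 d, 0 < d & forall s, t <= s -> s < t + d -> f s < a.
Proof.
move=> rf t0 aft.
have [|d d0 dP] := @right_continuous_dist f t (a - f t) rf t0; first by rewrite subr_gt0.
exists d => // s ts std; have := dP s ts std.
by rewrite ltr_norml; lra.
Qed.

(* A countable description of [a < running_sup f u] for right-continuous f; it
   makes sense, and is measurable, for arbitrary f. *)
Definition running_sup_gt_rat (a : R) f u : Prop :=
  exists b : rat, a < ratr b /\ forall n : nat, exists q : rat,
    [/\ 0 <= ratr q :> R, ((ratr q - n.+1%:R^-1)%:E < u)%E & ratr b < f (ratr q)].

(** The supremum may exceed a only at time u itself, where u is irrational; hence the rational times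
    may overshoot u by less than [n.+1%:R^-1]. As n grows such times are forced towards u, and the
    fixed rational b strictly above a keeps the inequality strict in the right limit. *)
Lemma running_sup_gt_ratP f u (a : R) : right_continuous f ->
  (a%:E < running_sup f u)%E <-> running_sup_gt_rat a f u.
Proof.
move=> rf; split.
  case/running_sup_gtP => s [s0 su afs].
  have [b] := rat_in_itvoo afs; rewrite in_itv/= => /andP[ab bs].
  exists b; split => // n.
  have [d d0 dP] := right_continuous_gt rf s0 bs.
  have [|q] := @rat_in_itvoo _ s (s + Num.min d n.+1%:R^-1).
    by rewrite ltrDl lt_min d0 invr_gt0 ltr0n.
  rewrite in_itv/= => /andP[sq]; rewrite -ltrBlDl lt_min => /andP[qd qn].
  exists q; split; first by rewrite (le_trans s0)// ltW.
    by apply: lt_le_trans su; rewrite lte_fin ltrBlDr -ltrBlDl.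
  by apply: dP; [exact: ltW|lra].
case=> b [ab bP]; apply/running_sup_gtP.
have [q0 [q00 q0u _]] := bP 0.
case: u => [u| |] in bP q0u *.
- have [u0|u0] := leP 0 u; last first.
    have [n nu] : exists n : nat, n.+1%:R^-1 < - u.
      by apply: invS_lt; rewrite oppr_gt0.
    have [q [q1 q2 _]] := bP n; exfalso; move: q2 q1 nu; rewrite lte_fin.
    by set z := _^-1; lra.
  have [bu|ub] := ltP (ratr b) (f u); first by exists u; split => //; exact: lt_trans bu.
  have [/(lt_le_trans ab) afu|fub] := leP (ratr b) (f u); first by exists u.
  have [d d0 dP] := right_continuous_lt rf u0 fub.
  have [n nd] := invS_lt d0.
  have [q [q1 q2 q3]] := bP n; exists (ratr q); split => //; last exact: lt_trans q3.
  rewrite lee_fin leNgt; apply/negP => uq.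
  have := dP (ratr q) (ltW uq); move: q2 q3 nd; rewrite lte_fin.
  by set z := _^-1 => ? ? ? /(_ ltac:(lra)); lra.
- have [q [q1 _ q3]] := bP 0; exists (ratr q); split => //; first exact: leey.
  exact: lt_trans q3.
- by move: q0u; rewrite ltNge leNye.
Qed.

Lemma measurable_running_sup_gt_rat d (S : measurableType d) (Y : R -> S -> R)
    (U : S -> \bar R) (a : R) :
  (forall s, 0 <= s -> measurable_fun setT (Y s)) -> measurable_fun setT U ->
  measurable [set w | running_sup_gt_rat a (Y ^~ w) (U w)].
Proof.
move=> mY mU.
rewrite [X in measurable X](_ : _ = \bigcup_(b : rat) (if a < ratr b then
  \bigcap_(n : nat) \bigcup_(q : rat) (if 0 <= ratr q :> R then
  (U @^-1` `](ratr q - n.+1%:R^-1)%:E, +oo[) `&` (Y (ratr q) @^-1` `]ratr b, +oo[)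
  else set0) else set0)).
  apply: bigcupT_measurable_rat => b; case: ifPn => // ab.
  apply: bigcapT_measurable => n.
  apply: bigcupT_measurable_rat => q; case: ifPn => // q0.
  apply: measurableI.
  - by rewrite -[X in measurable X]setTI; apply: mU => //; exact: emeasurable_itv.
  - by rewrite -[X in measurable X]setTI; apply: mY.
apply/seteqP; split => w /=.
  case=> b [ab bP].
  exists b => //; rewrite ab => n _; have [q [q0 qu qb]] := bP n.
  by exists q => //; rewrite q0; split; rewrite /= in_itv/= andbT.
case=> b _; case: ifPn => // ab bP; exists b; split => // n.
have [q _] := bP n I; case: ifPn => // q0 [] /=; rewrite !in_itv/= !andbT => ? ?.
by exists q.
Qed.

Lemma measurable_running_sup d (S : measurableType d) (Y : R -> S -> R)
    (U : S -> \bar R) :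
  (forall s, 0 <= s -> measurable_fun setT (Y s)) -> measurable_fun setT U ->
  (forall w, right_continuous (Y ^~ w)) ->
  measurable_fun setT (fun w => running_sup (Y ^~ w) (U w)).
Proof.
move=> mY mU rY mS; apply: (measurability _ (ErealGenOInfty.measurableE R)) => //.
move=> _ [_ [a ->] <-]; rewrite setTI.
rewrite [X in measurable X](_ : _ = [set w | running_sup_gt_rat a (Y ^~ w) (U w)]).
  exact: measurable_running_sup_gt_rat.
apply/seteqP; split => w /=; rewrite in_itv/= andbT.
  by move/(running_sup_gt_ratP _ _ (rY w)).
by move=> ?; apply/(running_sup_gt_ratP _ _ (rY w)).
Qed.

End running_sup.

(** * Laws, paths and integrals *)

(** The half-lines and the whole space form a pi-system. The total mass is a separate hypothesis
    because no half-line contains [-oo]. *)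
Lemma ereal_measure_unique (R : realType) (m1 m2 : {measure set \bar R -> \bar R}) :
  (m1 setT < +oo)%E -> m1 setT = m2 setT ->
  (forall a : R, m1 `]a%:E, +oo[%classic = m2 `]a%:E, +oo[%classic) ->
  forall B, measurable B -> m1 B = m2 B.
Proof.
move=> m1y m12 m12a B mB.
pose G := [set A : set \bar R | A = setT \/ exists a : R, A = `]a%:E, +oo[%classic].
apply: (measure_unique G (fun=> setT)) => //.
- apply/seteqP; split.
    rewrite [X in X `<=` _](ErealGenOInfty.measurableE R).
    by apply: sub_sigma_algebra2 => _ [r ->]; right; exists r.
  apply: smallest_sub; first exact: sigma_algebra_measurable.
  by move=> _ [->|[a ->]]; [exact: measurableT|exact: emeasurable_itv].
- move=> _ _ [->|[a ->]] [->|[b ->]]; rewrite ?setTI ?setIT.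
  + by left.
  + by right; exists b.
  + by right; exists a.
  + right; exists (Num.max a b); apply/seteqP; split => x /=.
      by rewrite !in_itv/= !andbT EFin_max gt_max => -[-> ->].
    by rewrite !in_itv/= !andbT EFin_max gt_max => /andP[].
- by move=> i; left.
- by apply/seteqP; split => // x _; exists 0%N.
- by move=> A [->|[a ->]].
Qed.

Lemma ereal_eq_gt (R : realType) (x y : \bar R) :
  (forall a : R, (a%:E < x)%E <-> (a%:E < y)%E) -> x = y.
Proof.
have H (x' y' : \bar R) : (forall a : R, (a%:E < x')%E -> (a%:E < y')%E) -> (x' <= y')%E.
  move=> xy; rewrite leNgt; apply/negP => yx.
  case: x' y' yx xy => [x'| |] [y'| |]//= yx xy.
  - by have := xy y' yx; rewrite ltxx.
  - by have := xy (x' - 1); rewrite lte_fin => /(_ ltac:(lra)); rewrite ltNge leNye.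
  - by have := xy y' yx; rewrite ltxx.
  - by have := xy 0 (ltry 0); rewrite ltNge leNye.
by move=> xy; apply/le_anti/andP; split; apply: H => a /xy.
Qed.

Section sup_from.
Context {R : realType}.
Implicit Types (f : R -> R) (u : \bar R) (t : R).

Definition sup_from t f u : \bar R :=
  ereal_sup [set (f s)%:E | s in [set s | t <= s /\ (s%:E <= u)%E]].

Lemma sup_from_gtP t f u (a : R) :
  (a%:E < sup_from t f u)%E <-> exists s, [/\ t <= s, (s%:E <= u)%E & a < f s].
Proof.
split.
  by case/ereal_sup_gt => _ [s [s0 su] <-]; rewrite lte_fin => afs; exists s.
case=> s [s0 su afs]; apply: (@lt_le_trans _ _ (f s)%:E); first by rewrite lte_fin.
by apply: ereal_sup_ubound; exists s.
Qed.

Lemma sup_from_shift t f u :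
  sup_from t f (t%:E + u) = ((f t)%:E + running_sup (fun s => f (t + s) - f t)%R u)%E.
Proof.
apply: ereal_eq_gt => a; rewrite -lteBlDl// -EFinB sup_from_gtP running_sup_gtP.
split => -[s [ts su H]].
  exists (s - t); split; first by rewrite subr_ge0.
    by rewrite EFinB leeBlDl.
  by rewrite [t + _]addrC subrK ltrD2r.
exists (t + s); split; first by rewrite lerDl.
  by rewrite EFinD leeD2lE.
lra.
Qed.

Lemma sup_from_running t f u :
  sup_from t f u = running_sup (fun s => f (t + s)) (u - t%:E)%E.
Proof.
apply: ereal_eq_gt => a; rewrite sup_from_gtP running_sup_gtP.
split => -[s [ts su H]].
  exists (s - t); split; first by rewrite subr_ge0.
    by rewrite leeBrDl// -EFinD (_ : t + (s - t) = s)//; ring.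
  by rewrite [t + _]addrC subrK.
exists (t + s); split => //; first by rewrite lerDl.
by rewrite EFinD addeC -leeBrDr.
Qed.

Lemma sup_from_le t f u : 0 <= t -> (sup_from t f u <= running_sup f u)%E.
Proof.
move=> t0; apply: ereal_sup_le => _ [s [ts su] <-].
by exists s => //; split => //; exact: le_trans ts.
Qed.

End sup_from.

Section image_measure.
Context d1 d2 (T1 : measurableType d1) (T2 : measurableType d2) (R : realType).
Context (m : {measure set T1 -> \bar R}) (f : T1 -> T2).
Context (mf : measurable_fun [set: T1] f).

(** The proof of measurability is an argument so that the measure structure of the image can be
    inferred from the term. *)
Definition image_measure of measurable_fun [set: T1] f := pushforward m f.

Let image_measure0 : image_measure mf set0 = 0%E.
Proof. by rewrite /image_measure /pushforward preimage_set0 measure0. Qed.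

Let image_measure_ge0 A : (0 <= image_measure mf A)%E.
Proof. exact: measure_ge0. Qed.

Let image_measure_sigma_additive : semi_sigma_additive (image_measure mf).
Proof.
move=> F mF tF mUF; rewrite /image_measure /pushforward preimage_bigcup.
apply: measure_semi_sigma_additive.
- by move=> n; rewrite -[X in measurable X]setTI; exact: mf.
- apply/trivIsetP => /= i j _ _ ij; rewrite -preimage_setI.
  by move/trivIsetP : tF => /(_ _ _ _ _ ij) ->//; rewrite preimage_set0.
- by rewrite -preimage_bigcup -[X in measurable X]setTI; exact: mf.
Qed.

HB.instance Definition _ := isMeasure.Build _ _ _ (image_measure mf)
  image_measure0 image_measure_ge0 image_measure_sigma_additive.

End image_measure.

Lemma ereal_law_unique d1 d2 (S1 : measurableType d1) (S2 : measurableType d2)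
    (R : realType) (m1 : {measure set S1 -> \bar R}) (m2 : {measure set S2 -> \bar R})
    (f1 : S1 -> \bar R) (f2 : S2 -> \bar R) :
  measurable_fun setT f1 -> measurable_fun setT f2 ->
  (m1 setT < +oo)%E -> m1 setT = m2 setT ->
  (forall a : R, m1 [set w | a%:E < f1 w]%E = m2 [set w | a%:E < f2 w]%E) ->
  forall B, measurable B -> m1 (f1 @^-1` B) = m2 (f2 @^-1` B).
Proof.
move=> mf1 mf2 m1y m12 m12a B mB.
have := @ereal_measure_unique R (image_measure m1 mf1) (image_measure m2 mf2).
apply => //= a; have := m12a a; rewrite /image_measure /pushforward.
have H (S : Type) (f : S -> \bar R) :
    f @^-1` `]a%:E, +oo[%classic = [set w | a%:E < f w]%E.
  by apply/seteqP; split => w /=; rewrite in_itv/= andbT.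
by rewrite !H.
Qed.

Lemma pair_law_unique d1 d2 d3 d4 (S1 : measurableType d1) (S2 : measurableType d2)
    (T1 : measurableType d3) (T2 : measurableType d4)
    (R : realType) (m1 : {measure set S1 -> \bar R}) (m2 : {measure set S2 -> \bar R})
    (f1 : S1 -> T1 * T2) (f2 : S2 -> T1 * T2) :
  measurable_fun setT f1 -> measurable_fun setT f2 ->
  (m1 setT < +oo)%E ->
  (forall A B, measurable A -> measurable B ->
     m1 (f1 @^-1` (A `*` B)) = m2 (f2 @^-1` (A `*` B))) ->
  forall D, measurable D -> m1 (f1 @^-1` D) = m2 (f2 @^-1` D).
Proof.
move=> mf1 mf2 m1y m12 D mD.
pose C : set (set (T1 * T2)) :=
  [set C | exists A, measurable A /\ exists B, measurable B /\ C = A `*` B].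
have := @measure_unique _ R _ C (fun=> setT) _ _ _ _
  (image_measure m1 mf1) (image_measure m2 mf2); apply => //=.
- rewrite measurable_prod_measurableType //; congr (<<s _ >>).
  rewrite predeqE; split => [[A mA [B mB <-]]|[A [mA [B [mB ->]]]]].
    by exists A; split => //; exists B.
  by exists A => //; exists B.
- move=> /= _ _ [X1 [mX1 [X2 [mX2 ->]]]] [Y1 [mY1 [Y2 [mY2 ->]]]].
  rewrite -setXI; exists (X1 `&` Y1); split; first exact: measurableI.
  by exists (X2 `&` Y2); split => //; exact: measurableI.
- move=> i; exists setT; split => //; exists setT; split => //.
  by rewrite setXTT.
- by apply/seteqP; split => // x _; exists 0%N.
- by move=> _ [A [mA [B [mB ->]]]]; exact: m12.
Qed.

Section paths.
Context {R : realType}.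
Implicit Types (f : R -> R).

Definition path_gen : set (set (R -> R)) :=
  [set A | exists t, exists B : set R,
        [/\ 0 <= t, measurable B & A = [set f | B (f t)]]].

(** The measurable sets of this type are the [path_events] of [family_law] and
    [killing_independent]. Its points are arbitrary functions, without any regularity. *)
Definition path_space := g_sigma_algebraType path_gen.

Lemma measurable_coordinate (t : R) : 0 <= t ->
  measurable_fun setT (fun f : path_space => f t).
Proof.
move=> t0 _ B mB; rewrite setTI; apply: sub_sigma_algebra.
by exists t, B.
Qed.

Lemma measurable_path d (S : measurableType d) (Y : R -> S -> R) :
  (forall t, 0 <= t -> measurable_fun setT (Y t)) ->
  measurable_fun setT (fun w => Y ^~ w : path_space).
Proof.
move=> mY; apply: (@measurability _ _ _ path_space setT _ path_gen erefl).
move=> _ [_ [t [B [t0 mB ->]]] <-].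
by apply: mY.
Qed.

(* The maximum of f - f s over the grid s, s + e, ..., s + m e, by recursion on the
   first increment, which is independent of the maximum over the later ones. *)
Fixpoint incr_max f (e : R) m s : R :=
  if m is m'.+1 then Num.max 0 (f (s + e) - f s + incr_max f e m' (s + e)) else 0.

Lemma measurable_incr_max d (S : measurableType d) (Y : R -> S -> R) e m s :
  0 <= e -> 0 <= s -> (forall t, 0 <= t -> measurable_fun setT (Y t)) ->
  measurable_fun setT (fun w => incr_max (Y ^~ w) e m s).
Proof.
move=> e0 s0 mY; elim: m s s0 => [|m IH] s s0 /=; first exact: measurable_cst.
apply: measurable_maxr => //; apply: measurable_funD.
  by apply: measurable_funB; apply: mY => //; exact: addr_ge0.
by apply: IH; exact: addr_ge0.
Qed.

Lemma incr_max_gtP f e m s a : a < incr_max f e m s <->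
  exists2 i : nat, (i <= m)%N & a < f (s + i%:R * e) - f s.
Proof.
elim: m s a => [|m IH] s a /=.
  split; first by exists 0%N => //; rewrite mul0r addr0 subrr.
  by case=> i; rewrite leqn0 => /eqP ->; rewrite mul0r addr0 subrr.
rewrite lt_max; split.
  case/orP => [a0|]; first by exists 0%N => //; rewrite mul0r addr0 subrr.
  rewrite -ltrBlDl => /IH[i im]; rewrite ltrBlDl => H; exists i.+1 => //.
  have -> : s + i.+1%:R * e = s + e + i%:R * e by rewrite -natr1; ring.
  lra.
case=> -[_|i im].
  by rewrite mul0r addr0 subrr => ->.
have -> : s + i.+1%:R * e = s + e + i%:R * e by rewrite -natr1; ring.
move=> H.
apply/orP; right; rewrite -ltrBlDl; apply/IH; exists i => //; lra.
Qed.

End paths.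

Section image_probability.
Context d1 d2 (T1 : measurableType d1) (T2 : measurableType d2) (R : realType).
Context (m : probability T1 R) (f : T1 -> T2) (mf : measurable_fun [set: T1] f).

Let image_measureT : image_measure m mf setT = 1%E.
Proof. by rewrite /image_measure /pushforward preimage_setT; exact: probability_setT. Qed.

HB.instance Definition _ :=
  Measure_isProbability.Build _ _ _ (image_measure m mf) image_measureT.

End image_probability.

Lemma ge0_integral_law_eq d1 d2 d3 (S1 : measurableType d1) (S2 : measurableType d2)
    (T1 : measurableType d3) (R : realType)
    (m1 : {measure set S1 -> \bar R}) (m2 : {measure set S2 -> \bar R})
    (f1 : S1 -> T1) (f2 : S2 -> T1) (H : T1 -> \bar R) :
  measurable_fun setT f1 -> measurable_fun setT f2 ->
  (forall B, measurable B -> m1 (f1 @^-1` B) = m2 (f2 @^-1` B)) ->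
  measurable_fun setT H -> (forall y, 0 <= H y)%E ->
  (\int[m1]_x H (f1 x) = \int[m2]_x H (f2 x))%E.
Proof.
move=> mf1 mf2 m12 mH H0.
transitivity (\int[image_measure m1 mf1]_y H y)%E.
  by rewrite (@ge0_integral_pushforward _ _ _ _ _ _ mf1)// preimage_setT.
transitivity (\int[image_measure m2 mf2]_y H y)%E.
  by apply: eq_measure_integral => B mB _; exact: m12.
by rewrite (@ge0_integral_pushforward _ _ _ _ _ _ mf2)// preimage_setT.
Qed.

(** Turns an identity between integrals over an event into an equality of laws under restricted
    measures. *)
Lemma ge0_integral_mrestr d1 (S1 : measurableType d1) (R : realType)
    (m : {measure set S1 -> \bar R}) (D : set S1) (mD : measurable D) (f : S1 -> \bar R) :
  measurable_fun setT f -> (forall y, 0 <= f y)%E ->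
  (\int[mrestr m mD]_x f x = \int[m]_(x in D) f x)%E.
Proof.
move=> mf f0; transitivity (\int[mrestr m mD]_(x in D) f x)%E; last first.
  by apply: eq_measure_integral => A mA AD; rewrite /= /mrestr setIidl.
rewrite (@ge0_negligible_integral _ _ _ _ setT (~` D))//.
- by rewrite setDE setCK setTI.
- exact: measurableC.
- by rewrite /= /mrestr setICl measure0.
Qed.

Lemma product_measure_ysection d1 d2 (T1 : measurableType d1) (T2 : measurableType d2)
    (R : realType) (m1 : {sigma_finite_measure set T1 -> \bar R})
    (m2 : {sigma_finite_measure set T2 -> \bar R}) (A : set (T1 * T2)) :
  measurable A -> ((m1 \x m2) A = \int[m2]_y m1 (ysection A y))%E.
Proof.
move=> mA.
have := @fubini_tonelli2 _ _ _ _ _ m1 m2 (fun z => (\1_A z)%:E) _ _.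
rewrite integral_indic// setIT => ->//; last first.
  exact/measurable_EFinP/measurable_indic.
apply: eq_integral => y _; rewrite /fubini_G.
rewrite -[in RHS](setIT (ysection A y)) -integral_indic//; last exact: measurable_ysection.
by apply: eq_integral => x _; rewrite !indicE mem_ysection.
Qed.

(** * Dyadic times *)

Section dyadic.
Context {R : realType}.
Implicit Types (s e : R).

Lemma dyadic_small e : 0 < e -> exists N, forall n, (N <= n)%N -> 2 ^- n < e.
Proof.
move=> /invS_lt[N Ne]; exists N => n Nn; apply: le_lt_trans Ne.
rewrite lef_pV2 ?posrE ?exprn_gt0 ?ltr0n// -natrX ler_nat.
exact: leq_ltn_trans Nn (ltn_expl _ _).
Qed.

(** For s >= 0, the least multiple of [2 ^- n] strictly above s, even when s is itself a multiple.
    It equals [k.+1%:R * 2 ^- n] exactly on the half-open interval that starts at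
    [k%:R * 2 ^- n]. *)
Definition dyadic_ceil n s : R := (Num.truncn (s * 2 ^+ n)).+1%:R * 2 ^- n.

Lemma dyadic_ceil_gt n s : 0 <= s -> s < dyadic_ceil n s.
Proof.
move=> s0; rewrite /dyadic_ceil ltr_pdivlMr ?exprn_gt0//.
exact: Num.Theory.truncnS_gt.
Qed.

Lemma dyadic_ceil_le n s : 0 <= s -> dyadic_ceil n s <= s + 2 ^- n.
Proof.
move=> s0; rewrite /dyadic_ceil -natr1 mulrDl mul1r lerD2r.
rewrite ler_pdivrMr ?exprn_gt0//.
by rewrite Num.Theory.truncn_le// mulr_ge0.
Qed.

Lemma dyadic_ceil_ge0 n s : 0 <= dyadic_ceil n s.
Proof. by rewrite mulr_ge0// invr_ge0 exprn_ge0. Qed.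

(** A proposition depending on n is coded as a set of [unit], so that monotonicity in n is
    inclusion. Halving the step refines the grid: index i becomes 2i. *)
Lemma incr_max_nondecreasing (f : R -> R) u s a : 0 <= u ->
  {homo (fun n => [set w : unit | a < incr_max f (u * 2 ^- n) (2 ^ n) s])
    : m n / (m <= n)%N >-> m `<=` n}.
Proof.
move=> u0; apply: homo_leq => [A|A B C|n]; first exact.
  exact: subset_trans.
move=> tt0 /= /incr_max_gtP[i im H]; apply/incr_max_gtP.
exists (2 * i)%N; first by rewrite expnS leq_mul2l.
rewrite natrM exprS invfM.
by have -> : 2%:R * i%:R * (u * (2^-1 * 2 ^- n)) = i%:R * (u * 2 ^- n) by field.
Qed.

End dyadic.

(** Fatou's lemma for sets: the intersections increase with n, and each lies in [C n]. *)
Lemma measure_liminf_le d (S : measurableType d) (R : realType)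
    (m : {measure set S -> \bar R}) (C : (set S)^nat) (c : \bar R) :
  (forall n, measurable (C n)) -> (forall n, m (C n) <= c)%E ->
  (m (\bigcup_n \bigcap_(k in [set k | (n <= k)%N]) C k) <= c)%E.
Proof.
move=> mC Cc.
pose B n := \bigcap_(k in [set k | (n <= k)%N]) C k.
have mB n : measurable (B n) by exact: bigcap_measurableType.
have BC n : (m (B n) <= c)%E.
  apply: le_trans (Cc n); apply: le_measure; rewrite ?inE//.
  by move=> w; apply; exact: leqnn.
have cvgB : m (B n) @[n --> \oo] --> m (\bigcup_n B n).
  apply: nondecreasing_cvg_mu => //; first exact: bigcup_measurable.
  move=> i j ij; apply/subsetPset => w Biw k /= jk; apply: Biw => /=.
  exact: leq_trans jk.
rewrite -(cvg_lim (@ereal_hausdorff R) cvgB); apply: lime_le.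
  by apply/cvg_ex; exists (m (\bigcup_n B n)).
exact: nearW.
Qed.

Lemma seqDUP (S : Type) (V : (set S)^nat) k w :
  seqDU V k w <-> V k w /\ forall i, (i < k)%N -> ~ V i w.
Proof.
rewrite /seqDU -bigcup_mkord; split => -[Vk H]; split => //.
  by move=> i ik Vi; apply: H; exists i.
by case=> i /= ik; exact: H.
Qed.

(* The first dyadic times of level m at which f exceeds xs - iv n approach,
   from strictly below, the time at which f creeps up to xs. *)
Lemma left_approach (R : realType) (iv : nat -> R) (f : R -> R) (xs t : R) :
  (forall n, 0 < iv n) -> (forall n n', (n <= n')%N -> iv n' <= iv n) ->
  (forall e, 0 < e -> exists n, iv n < e) ->
  right_continuous f -> 0 <= t -> (forall s, 0 <= s -> s <= t -> f s < xs) ->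
  (forall n : nat, exists s, [/\ 0 <= s, s <= t & xs - iv n < f s]) ->
  exists i j0 : nat, forall j, (j0 <= j)%N -> exists n0, forall n, (n0 <= n)%N ->
  exists m0, forall m, (m0 <= m)%N -> exists k : nat,
  [/\ xs - iv n < f (k%:R * 2 ^- m),
      forall k', (k' < k)%N -> ~ xs - iv n < f (k'%:R * 2 ^- m) &
      f (k%:R * 2 ^- m + iv j) - f (k%:R * 2 ^- m) < - iv i].
Proof.
move=> iv0 invS iv_lt rf t0 flt fgt.
(* [T0 = inf S] is the time at which f has come arbitrarily close to [xs]. Since [f T0 < xs],
   right-continuity keeps f below [xs - h] on [[T0, T0 + D[]. *)
pose S := [set s : R | [/\ 0 <= s, s <= t & forall n : nat,
  exists s', [/\ 0 <= s', s' <= s & xs - iv n < f s']]].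
have St : S t by [].
have S0 : has_inf S by split; [exists t|exists 0 => s []].
set T0 := inf S.
have T00 : 0 <= T0 by apply: lb_le_inf; [exists t|move=> s []].
have T0t : T0 <= t by apply: ge_inf => //; case: S0.
have fT0 := flt T0 T00 T0t.
pose h := (xs - f T0) / 2.
have h0 : 0 < h by rewrite divr_gt0// subr_gt0.
have [D D0 DP] : exists2 D, 0 < D & forall s, T0 <= s -> s < T0 + D -> f s < xs - h.
  by apply: right_continuous_lt => //; rewrite /h; lra.
have h20 : 0 < h / 2 by rewrite divr_gt0.
(* The drop is from above [xs - iv i] to below [xs - h]; the choice [iv i < h / 2] makes it larger
   than [iv i]. *)
have [i ih] := iv_lt _ h20.
have [j0 j0D] := iv_lt _ D0.
exists i, j0 => j j0j.
have jD : iv j < D by exact: le_lt_trans (invS _ _ j0j) j0D.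
set h' := iv j in jD *.
have h'0 : 0 < h' by exact: iv0.
have [y [[y0 yt yP] yD]] : exists y, S y /\ y < T0 + D.
  have [y Sy yT] : exists2 y, S y & y < T0 + D.
    by apply: inf_adherent => //; rewrite ltrDl.
  by exists y.
(* Values within [iv i] of [xs] are impossible on [[T0, T0 + D[], so the approach takes place
   strictly before [T0]. *)
have C1 n : exists s', [/\ 0 <= s', s' < T0 & xs - iv n < f s'].
  have [s' [s'0 s'y Hs']] := yP (maxn n i).
  exists s'; split => //; last first.
    apply: le_lt_trans Hs'; rewrite lerD2l lerN2; apply: invS; exact: leq_maxl.
  rewrite ltNge; apply/negP => Ts'.
  have := DP s' Ts' (le_lt_trans s'y yD).
  have : iv (maxn n i) <= iv i by apply: invS; exact: leq_maxr.
  lra.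
(* By minimality of [T0], f keeps a distance [iv n2] from [xs] up to time [T0 - h']. For n >= n2 the
   first passage thus occurs during the last [h'] before [T0], and waiting [h'] longer lands between
   [T0] and [T0 + D]. *)
have [n2 C2] : exists n2 : nat, forall s', 0 <= s' -> s' <= T0 - h' -> f s' <= xs - iv n2.
  apply: contrapT => /forallNP H.
  have S' : S (T0 - h').
    have H' n : exists s', [/\ 0 <= s', s' <= T0 - h' & xs - iv n < f s'].
      have /existsNP[s' H'] := H n; exists s'.
      move/not_implyP : H' => [s'0 /not_implyP[s'T /negP]].
      by rewrite -ltNge.
    split => //; last lra.
    by have [s' [s'0 s'T _]] := H' 0%N; exact: le_trans s'T.
  have : T0 <= T0 - h' by apply: ge_inf => //; case: S0.
  lra.
exists (maxn i n2) => n; rewrite geq_max => /andP[i_n n2n].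
have [s' [s'0 s'T Hs']] := C1 n.
have [D' D'0 D'P] := right_continuous_gt rf s'0 Hs'.
have [m0 m0P] := @dyadic_small R (Num.min D' (T0 - s'))
  ltac:(by rewrite lt_min D'0 subr_gt0).
exists m0 => m /m0P; rewrite lt_min => /andP[mD' mT].
have ex : exists k : nat, xs - iv n < f (k%:R * 2 ^- m).
  exists (Num.truncn (s' * 2 ^+ m)).+1.
  have := dyadic_ceil_gt m s'0; have := dyadic_ceil_le m s'0.
  by move=> ? ?; apply: D'P; rewrite -/(dyadic_ceil m s'); lra.
have [k kP kmin] := ex_minnP ex.
have kT : k%:R * 2 ^- m < T0.
  have : k%:R * 2 ^- m <= dyadic_ceil m s'.
    rewrite ler_wpM2r ?invr_ge0 ?exprn_ge0// ler_nat; apply: kmin.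
    have := dyadic_ceil_gt m s'0; have := dyadic_ceil_le m s'0.
    by move=> ? ?; apply: D'P; rewrite -/(dyadic_ceil m s'); lra.
  by have := dyadic_ceil_le m s'0; lra.
have k0 : 0 <= k%:R * 2 ^- m :> R by rewrite mulr_ge0// invr_ge0 exprn_ge0.
have kT' : T0 - h' < k%:R * 2 ^- m.
  rewrite ltNge; apply/negP => /(C2 _ k0).
  by have := invS _ _ n2n; lra.
exists k; split => //.
  by move=> k' k'k /kmin; rewrite leqNgt k'k.
have := DP (k%:R * 2 ^- m + h') ltac:(lra) ltac:(lra).
by have := invS _ _ i_n; lra.
Qed.

(** * Extended-valued functions and lower limits *)

Section ereal_ext.
Context {R : realType}.
Implicit Types (h : R -> R) (z : \bar R).
Local Open Scope ereal_scope.

(* Applied to h constant on the negative half-line and growing at +oo. *)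
Definition ereal_ext h z : \bar R :=
  match z with x%:E => (h x)%:E | +oo => +oo | -oo => (h 0%R)%:E end.

Lemma ereal_ext_ge0 h z : (forall x, 0 <= h x)%R -> 0 <= ereal_ext h z.
Proof. by move=> h0; case: z => [x| |] //=; rewrite lee_fin. Qed.

Lemma le_ereal_ext h : {homo h : x y / (x <= y)%R} ->
  (forall x, (x <= 0)%R -> h x = h 0%R) ->
  {homo ereal_ext h : x y / x <= y}.
Proof.
move=> hh h0 [x| |] [y| |] //=; rewrite ?lee_fin//; rewrite ?leey//.
- exact: hh.
- move=> _; have [y0|y0] := leP y 0%R; first by rewrite h0.
  by apply: hh; exact: ltW.
Qed.

Lemma measurable_ereal_ext h : measurable_fun setT h ->
  measurable_fun setT (ereal_ext h).
Proof.
move=> mh.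
rewrite (_ : ereal_ext h =
    fun z => if z \in [set +oo] then +oo else (h (fine z))%:E); last first.
  apply/funext => -[x| |] /=; first by rewrite memNset.
    by rewrite mem_set.
  by rewrite memNset.
apply: measurable_fun_ifT => //.
- apply: (@measurable_fun_bool _ _ _ _ true).
  rewrite setTI (_ : _ @^-1` _ = [set +oo]); first exact: emeasurable_set1.
  by apply/seteqP; split => z /=; [move/set_mem|move/mem_set].
- by apply/measurable_EFinP; apply: measurableT_comp.
Qed.

End ereal_ext.

Lemma limn_einf_ge (R : realType) (u : (\bar R)^nat) (c : \bar R) :
  (\forall n \near \oo, (c <= u n)%E) -> (c <= limn_einf u)%E.
Proof.
case=> N _ cu; rewrite limn_einf_lim; apply: lime_ge; first exact: is_cvg_einfs.
exists N => // n /= Nn; apply: le_ereal_inf_tmp => _ [m /= nm <-].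
by apply: cu => /=; exact: leq_trans nm.
Qed.

Lemma le_limn_einf (R : realType) (u v : (\bar R)^nat) :
  (forall n, (u n <= v n)%E) -> (limn_einf u <= limn_einf v)%E.
Proof.
move=> uv; rewrite !limn_einf_lim; apply: lee_lim; [exact: is_cvg_einfs..|].
apply: nearW => n; apply: le_ereal_inf_tmp => _ [m /= nm <-].
by apply: le_trans (uv m); apply: ereal_inf_lbound; exists m.
Qed.

Lemma measurable_fun_limn_einf d (S : measurableType d) (R : realType)
    (f : nat -> S -> \bar R) :
  (forall n, measurable_fun setT (f n)) ->
  measurable_fun setT (fun w => limn_einf (f ^~ w)).
Proof.
move=> mf; apply: (measurableT_comp (@oppe_measurable R setT)).
apply: (measurable_fun_limn_esup (f := fun n w => (- f n w)%E)) => n.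
exact: measurableT_comp.
Qed.

(** * Polynomial payoffs *)

Lemma pos_part_ge0 (R : realType) (y : R) : 0 <= pos_part y.
Proof. by rewrite le_max lexx orbT. Qed.

Lemma pos_part_id (R : realType) (y : R) : 0 <= y -> pos_part y = y.
Proof. by move=> y0; exact/max_idPl. Qed.

Lemma pos_part0 (R : realType) (y : R) : y <= 0 -> pos_part y = 0.
Proof. by move=> y0; exact/max_idPr. Qed.

Lemma continuous_max_cst (R : realType) (a : R) : continuous (fun y : R => Num.max y a).
Proof. by move=> y; apply: (@continuous_max R R); [exact: cvg_id|exact: cvg_cst]. Qed.

(** Because Q vanishes at a, the indicator amounts to freezing the argument at a; hence G is
    continuous. *)
Lemma truncated_polyE (R : realType) (Q : {poly R}) a y : root Q a ->
  truncated_poly Q a y = Q.[Num.max y a].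
Proof.
move=> Qa; rewrite /truncated_poly indicE; have [ya|ya] := ltP y a.
  by rewrite memNset ?mulr0 ?(rootP Qa)//= => /(lt_le_trans ya); rewrite ltxx.
by rewrite mem_set// mulr1.
Qed.

Lemma continuous_truncated_poly (R : realType) (Q : {poly R}) a : root Q a ->
  continuous (truncated_poly Q a).
Proof.
move=> Qa; rewrite (_ : truncated_poly Q a = horner Q \o (fun y => Num.max y a)).
  move=> y; apply: continuous_comp; first exact: continuous_max_cst.
  exact: continuous_horner.
by apply/funext => y; exact: truncated_polyE.
Qed.

Lemma continuous_poly_payoff (R : realType) (p : {poly R}) : continuous (poly_payoff p).
Proof.
move=> y; apply: (@continuous_comp _ _ _ (horner p \o pos_part) pos_part).
  apply: continuous_comp; first exact: continuous_max_cst.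
  exact: continuous_horner.
exact: continuous_max_cst.
Qed.

(** Source of the monotone majorant of g: with [1 + y^+] at least 1, its n-th power dominates every
    lower power. *)
Lemma poly_payoff_le (R : realType) (p : {poly R}) n y : (size p <= n.+1)%N ->
  poly_payoff p y <= (\sum_(i < n.+1) `|p`_i|) * (1 + pos_part y) ^+ n.
Proof.
move=> pn; have z0 := pos_part_ge0 y; rewrite /poly_payoff; set z := pos_part y in z0 *.
rewrite /pos_part ge_max; apply/andP; split; last first.
  by rewrite mulr_ge0 ?sumr_ge0// exprn_ge0// addr_ge0.
rewrite (horner_coef_wide _ pn); apply: (le_trans (ler_norm _)).
apply: (le_trans (ler_norm_sum _ _ _)); rewrite mulr_suml; apply: ler_sum => i _.
rewrite normrM ler_wpM2l// ger0_norm ?exprn_ge0//.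
apply: (@le_trans _ _ ((1 + z) ^+ i)); first by rewrite lerXn2r ?nnegrE; lra.
by apply: ler_weXn2l; [lra|rewrite -ltnS].
Qed.

(** * The law of the killing time *)

Section killing.
Context {R : realType} {d : measure_display} {T : measurableType d}.
Context (P : R -> probability T R) (X : R -> T -> R) (r : R) (e : T -> \bar R).
Hypothesis he : killing_time P X r e.
Hypothesis r0 : 0 <= r.
Implicit Types (t a b x : R) (u : \bar R).

Definition killing_law : set \bar R -> \bar R :=
  image_measure (P 0) (killing_measurable he).
Notation kap := killing_law.

HB.instance Definition _ := Probability.on kap.

(** The hypothesis on e only concerns sets of real numbers. The exponential density already has
    total mass 1 there, so e is infinite with probability 0. *)
Lemma killing_law_gt0 x B : 0 < r -> measurable B ->
  P x (e @^-1` B) = exponential_prob r (EFin @^-1` B).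
Proof.
move=> r0' mB; have mB' : measurable (EFin @^-1` B).
  by rewrite -[X in measurable X]setTI; exact: EFin_measurable.
have me B' : measurable B' -> measurable (e @^-1` B').
  by move=> mB0; rewrite -[X in measurable X]setTI; exact: (killing_measurable he).
rewrite -(killing_exponential he r0' x mB').
have mN : measurable (e @^-1` (EFin @` [set: R])).
  by apply: me; apply: measurable_image_EFin; exact: measurableT.
have N0 : P x (~` (e @^-1` (EFin @` [set: R]))) = 0%E.
  rewrite probability_setC// (killing_exponential he)//.
  by rewrite /exponential_prob integral_exponential_pdf// subee.
have -> : e @^-1` B =
    (e @^-1` (EFin @` (EFin @^-1` B))) `|` (e @^-1` B `\` e @^-1` (EFin @` [set: R])).
  apply/seteqP; split => w /=.
    case: (e w) => [v| |] H; first by left; exists v.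
    + by right; split => // -[].
    + by right; split => // -[].
  by case=> [[v ? <-]|[]].
rewrite measureU0//.
- by apply: me; exact: measurable_image_EFin.
- by apply: measurableD => //; exact: me.
- apply: (subset_measure0 _ _ _ N0).
  + by apply: measurableD => //; exact: me.
  + exact: measurableC.
  + by move=> w [].
Qed.

Lemma killing_lawE x B : measurable B -> P x (e @^-1` B) = kap B.
Proof.
move=> mB; have [r0'|r0'|r0'] := ltgtP 0 r.
- by rewrite killing_law_gt0//; apply/esym; exact: killing_law_gt0.
- by move: r0; rewrite leNgt r0'.
rewrite /killing_law /image_measure /pushforward.
have eE : e = cst +oo%E by apply/funext => w; exact: (killing_infinite he).
have [By|By] := pselect (B +oo%E).
  suff -> : e @^-1` B = setT by rewrite probability_setT; exact/esym/probability_setT.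
  by rewrite eE; apply/seteqP; split.
suff -> : e @^-1` B = set0 by rewrite !measure0.
by rewrite eE; apply/seteqP; split.
Qed.

Lemma killing_law_r0 B : r = 0 -> B +oo%E -> kap B = 1%E.
Proof.
move=> r00 By; rewrite /killing_law /image_measure /pushforward.
suff -> : e @^-1` B = setT by exact: probability_setT.
by apply/seteqP; split => // w _ /=; rewrite (killing_infinite he).
Qed.

Lemma killing_law_atomless a : kap [set a%:E] = 0%E.
Proof.
rewrite -(killing_lawE 0)//; have [r0'|r0'|r0'] := ltgtP 0 r.
- rewrite killing_law_gt0// (_ : EFin @^-1` [set a%:E] = [set a]).
    exact: integral_set1.
  by apply/seteqP; split => y /= => [[]|->].
- by move: r0; rewrite leNgt r0'.
suff -> : e @^-1` [set a%:E] = set0 by rewrite measure0.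
by apply/seteqP; split => // w /=; rewrite (killing_infinite he).
Qed.

Lemma killing_law_infinite : 0 < r -> kap [set +oo%E] = 0%E.
Proof.
move=> r0'; rewrite -(killing_lawE 0)// killing_law_gt0//.
rewrite (_ : EFin @^-1` [set +oo%E] = set0); first exact: integral_set0.
by apply/seteqP; split => y.
Qed.

Lemma killing_law_gt b : kap `]b%:E, +oo[%classic = (expR (- r * Num.max b 0))%:E.
Proof.
have [r0'|r0'|r0'] := ltgtP 0 r; last 2 first.
- by move: r0; rewrite leNgt r0'.
- rewrite killing_law_r0//; first by rewrite -r0' oppr0 mul0r expR0.
  by rewrite /= in_itv/= andbT ltry.
have kapE B : measurable B -> kap B = exponential_prob r (EFin @^-1` B).
  by move=> mB; rewrite -(killing_law_gt0 0)// killing_lawE.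
have neg : kap `]-oo, 0%:E[%classic = 0%E.
  rewrite kapE; last exact: emeasurable_itv.
  rewrite /exponential_prob integral0_eq// => y /=; rewrite in_itv/= lte_fin => y0.
  by rewrite lt0_exponential_pdf.
have [b0|b0] := ltP 0 b.
  have -> : `]b%:E, +oo[%classic =
      ~` (`[0%:E, b%:E]%classic `|` `]-oo, 0%:E[%classic) :> set (\bar R).
    apply/seteqP; split => u /=; rewrite !in_itv/= !andbT.
      move=> bu [/andP[_]|]; first by rewrite leNgt bu.
      by rewrite ltNge (le_trans _ (ltW bu))// lee_fin ltW.
    move=> H; rewrite ltNge; apply/negP => ub; apply: H.
    by have [u0|u0] := leP 0%:E u; [left; rewrite ub|right].
  rewrite probability_setC; last by apply: measurableU; exact: emeasurable_itv.
  rewrite measureU0//; [|exact: emeasurable_itv..].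
  rewrite [X in (1 - X)%E]kapE; last exact: emeasurable_itv.
  rewrite (_ : EFin @^-1` _ = `[0, b]%classic); last first.
    by apply/seteqP; split => y /=; rewrite !in_itv/= !lee_fin.
  by rewrite exponential_prob_itv0c// -EFinB; congr EFin; ring.
have -> : `]b%:E, +oo[%classic = ~` `]-oo, b%:E]%classic :> set (\bar R).
  by rewrite setCitvl.
rewrite probability_setC; last exact: emeasurable_itv.
rewrite mulr0 expR0.
suff H : kap `]-oo, b%:E]%classic = 0%E by rewrite [X in (1 - X)%E]H sube0.
have N1 : kap (`]-oo, 0%:E[%classic `|` [set 0%:E]) = 0%E.
  rewrite measureU0//; first exact: emeasurable_itv.
  exact: killing_law_atomless.
apply: (subset_measure0 _ _ _ N1) => //; first exact: emeasurable_itv.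
  by apply: measurableU => //; exact: emeasurable_itv.
move=> y /=; rewrite !in_itv/= => yb.
have : (y <= 0%:E)%E by rewrite (le_trans yb)// lee_fin.
by rewrite le_eqVlt => /orP[/eqP|]; [right|left].
Qed.

Lemma killing_law_ge t : 0 <= t ->
  kap [set u | t%:E <= u]%E = (expR (- r * t))%:E.
Proof.
move=> t0.
have -> : [set u | t%:E <= u]%E = `]t%:E, +oo[%classic `|` [set t%:E].
  apply/seteqP; split => u /=; rewrite in_itv/= andbT.
    by rewrite le_eqVlt => /orP[/eqP|]; [right|left].
  by case=> [/ltW//|->].
rewrite measureU0//; last 2 first.
- exact: emeasurable_itv.
- exact: killing_law_atomless.
by rewrite -[in RHS](max_idPl t0) -killing_law_gt.
Qed.

Lemma measurable_ge_set t : measurable [set u : \bar R | t%:E <= u]%E.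
Proof.
rewrite (_ : [set u | _] = `[t%:E, +oo[%classic); first exact: emeasurable_itv.
by apply/seteqP; split => u /=; rewrite in_itv/= andbT.
Qed.

(** The image of the law under translation by t, scaled by [expR (- r * t)], and the law restricted
    to times at least t agree on half-lines: beyond a >= t both have mass [expR (- r * a)], and
    beyond a < t both have mass [expR (- r * t)]. For r = 0 both are the point mass at [+oo]. *)
Lemma killing_memoryless t (Phi : \bar R -> \bar R) : 0 <= t ->
  measurable_fun setT Phi -> (forall u, 0 <= Phi u)%E ->
  ((expR (- r * t))%:E * \int[kap]_u Phi (t%:E + u) =
   \int[kap]_(u in [set u | t%:E <= u]) Phi u)%E.
Proof.
move=> t0 mPhi Phi0.
have mt : measurable_fun setT (fun u : \bar R => t%:E + u)%E.
  exact: emeasurable_funD.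
have mD := measurable_ge_set t.
pose c := NngNum (expR_ge0 (- r * t)).
pose m1 := mscale c (image_measure kap mt).
have m1E A : measurable A -> m1 A = mrestr kap mD A.
  move=> mA; apply: (@ereal_measure_unique R m1 (mrestr kap mD)) => //=.
  - change ((expR (- r * t))%:E * kap setT < +oo)%E.
    by rewrite [X in (_ * X)%E]probability_setT mule1 ltry.
  - change ((expR (- r * t))%:E * kap setT = kap (setT `&` [set u | t%:E <= u]))%E.
    rewrite [X in (_ * X)%E]probability_setT mule1 setTI.
    by rewrite [RHS]killing_law_ge.
  - move=> a; change ((expR (- r * t))%:E *
        kap ((fun u => t%:E + u) @^-1` `]a%:E, +oo[%classic) =
      kap (`]a%:E, +oo[%classic `&` [set u | t%:E <= u]))%E.
    have -> : (fun u => t%:E + u)%E @^-1` `]a%:E, +oo[%classic =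
        `](a - t)%:E, +oo[%classic.
      apply/seteqP; split => u /=; rewrite !in_itv/= !andbT EFinB.
        by rewrite lteBlDl.
      by rewrite lteBlDl.
    rewrite [X in (_ * X)%E]killing_law_gt -EFinM -expRD.
    have [ta|at_] := leP t a.
      rewrite (_ : _ `&` _ = `]a%:E, +oo[%classic); last first.
        apply/seteqP; split => u /=; rewrite in_itv/= andbT; first by case.
        by move=> au; split => //; rewrite (le_trans _ (ltW au))// lee_fin.
      rewrite [RHS]killing_law_gt !(max_idPl _) ?subr_ge0//; last exact: le_trans ta.
      by congr (expR _)%:E; ring.
    rewrite (_ : _ `&` _ = [set u | t%:E <= u]%E); last first.
      apply/seteqP; split => u /=; rewrite in_itv/= andbT; first by case.
      by move=> tu; split => //; rewrite (lt_le_trans _ tu)// lte_fin.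
    rewrite [RHS]killing_law_ge// (max_idPr _) ?mulr0 ?addr0//.
    by rewrite subr_le0 ltW.
transitivity (\int[m1]_(u in [set u | t%:E <= u]) Phi u)%E; last first.
  by apply: eq_measure_integral => A mA AD; apply: (eq_trans (m1E _ mA)); rewrite /mrestr setIidl.
have m1C : m1 (~` [set u | t%:E <= u]%E) = 0%E.
  rewrite m1E; last exact: measurableC.
  by rewrite /mrestr setICl measure0.
transitivity (\int[m1]_u Phi u)%E; last first.
  rewrite (@ge0_negligible_integral _ _ _ m1 setT (~` [set u | t%:E <= u]%E))//.
  - by rewrite setDE setCK setTI.
  - exact: measurableC.
rewrite /m1 ge0_integral_mscale//; congr (_ * _)%E.
by rewrite [RHS](@ge0_integral_pushforward _ _ _ _ _ _ mt)// preimage_setT.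
Qed.

End killing.

(** * Suprema of increments *)

Section levy.
Context {R : realType} {d : measure_display} {T : measurableType d}.
Context (P : R -> probability T R) (F : R -> set (set T)) (X : R -> T -> R).
Hypothesis hX : levy_family P F X.
Implicit Types (s t a x e : R) (w : T).

Lemma levy_filtration_sub t A : 0 <= t -> F t A -> measurable A.
Proof. by move=> t0; apply: (filtration_sub (family_usual hX) t0). Qed.

Lemma levy_filtration_mono s t A : 0 <= s -> s <= t -> F s A -> F t A.
Proof. by move=> s0 st; apply: (filtration_mono (family_usual hX) s0 st). Qed.

Lemma levy_measurable t : 0 <= t -> measurable_fun setT (X t).
Proof.
move=> t0 _ B mB; rewrite setTI; apply: (levy_filtration_sub t0).
exact: (levy_adapted (family_levy hX 0)).
Qed.

Lemma levy_right_continuous w : right_continuous (X ^~ w).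
Proof. exact: (levy_cadlag (family_levy hX 0) w).1. Qed.

(** Lets [F t] inherit the closure properties of measurable sets and functions. *)
Lemma filtration_measurableE t : 0 <= t ->
  @measurable _ (g_sigma_algebraType (F t)) = F t.
Proof.
move=> t0; apply: measurable_g_measurableTypeE.
exact: (filtration_sigma_algebra (family_usual hX)).
Qed.

Lemma levy_filtration_measurable s t : 0 <= s -> s <= t ->
  measurable_fun setT (X s : g_sigma_algebraType (F t) -> R).
Proof.
move=> s0 st _ B mB; rewrite setTI filtration_measurableE ?(le_trans s0 st)//.
by apply: (levy_filtration_mono s0 st); exact: (levy_adapted (family_levy hX 0)).
Qed.

Lemma filtrationI t A B : 0 <= t -> F t A -> F t B -> F t (A `&` B).
Proof. by move=> t0; rewrite -filtration_measurableE//; exact: measurableI. Qed.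

Lemma filtrationT t : 0 <= t -> F t setT.
Proof. by move=> t0; rewrite -filtration_measurableE//; exact: measurableT. Qed.

Lemma filtration_incr s t B : 0 <= s -> s <= t -> measurable B ->
  F t [set w | B (X t w - X s w)].
Proof.
move=> s0 st mB; rewrite -filtration_measurableE ?(le_trans s0 st)//.
have : measurable_fun setT
    ((fun w => X t w - X s w) : g_sigma_algebraType (F t) -> R).
  by apply: measurable_funB; apply: levy_filtration_measurable => //; exact: le_trans st.
by move=> /(_ measurableT B mB); rewrite setTI.
Qed.

(** By induction on m. The first increment is independent of [F s]; the maximum over the later ones
    is independent of [F (s + e)], which contains both A and the first increment. *)
Lemma incr_max_independent x e m s A B : 0 <= e -> 0 <= s -> F s A -> measurable B ->
  P x (A `&` [set w | B (incr_max (X ^~ w) e m s)]) =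
  (P x A * P x [set w | B (incr_max (X ^~ w) e m 0%R)])%E.
Proof.
move=> e0; elim: m s A B => [|m IH] s A B s0 FA mB /=.
  have [B0|B0] := pselect (B 0).
    rewrite (_ : [set w | B 0] = setT) ?setIT ?probability_setT ?mule1//.
    by apply/seteqP; split.
  rewrite (_ : [set w | B 0] = set0) ?setI0 ?measure0 ?mule0//.
  by apply/seteqP; split.
have mA := levy_filtration_sub s0 FA.
pose f s w := (X (s + e) w - X s w, incr_max (X ^~ w) e m (s + e)).
have mf s' : 0 <= s' -> measurable_fun setT (f s').
  move=> s'0; apply: measurable_fun_pair.
    by apply: measurable_funB; apply: levy_measurable => //; exact: addr_ge0.
  by apply: measurable_incr_max => //; [exact: addr_ge0|exact: levy_measurable].
pose D : set (R * R) := [set z | B (Num.max 0 (z.1 + z.2))].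
have mD : measurable D.
  have : measurable_fun setT (fun z : R * R => Num.max 0 (z.1 + z.2)).
    by apply: measurable_maxr => //; apply: measurable_funD.
  by move=> /(_ measurableT B mB); rewrite setTI.
have QA0 : 0 <= fine (P x A) by exact: fine_ge0.
pose c := NngNum QA0.
have QA : P x A = (c%:num)%:E by rewrite /= fineK ?fin_num_measure.
(* The factor of [P x A'] does not depend on [s']. Comparing the case of s and A with that of 0 and
   the whole space identifies the two joint laws on rectangles, hence on [D]. *)
have rect s' A' B1 B2 : 0 <= s' -> F s' A' -> measurable B1 -> measurable B2 ->
    P x (A' `&` f s' @^-1` (B1 `*` B2)) =
    (P x A' * (P x [set w | B1 (X e w - X 0 w)%R] *
               P x [set w | B2 (incr_max (X ^~ w) e m 0%R)]))%E.
  move=> s'0 FA' mB1 mB2.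
  have -> : A' `&` f s' @^-1` (B1 `*` B2) =
      (A' `&` [set w | B1 (X (s' + e) w - X s' w)]) `&`
      [set w | B2 (incr_max (X ^~ w) e m (s' + e))].
    by apply/seteqP; split => w /=; [case=> ? [? ?]|case=> -[? ?] ?].
  have s's'e : s' <= s' + e by rewrite lerDl.
  rewrite IH//; last 2 first.
    exact: addr_ge0.
    apply: filtrationI; first exact: addr_ge0.
      exact: levy_filtration_mono FA'.
    exact: filtration_incr.
  rewrite (levy_independent_increments (family_levy hX x))//.
  rewrite (levy_stationary_increments (family_levy hX x))//.
  by rewrite (addrC s') addrK muleA.
rewrite QA [LHS](_ : _ = mrestr (P x) mA (f s @^-1` D)); last first.
  by rewrite /mrestr setIC.
rewrite (@pair_law_unique _ _ _ _ _ _ _ _ _ _ (mscale c (P x)) _ (f 0)) //.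
- exact: mf.
- exact: mf.
- by rewrite /= /mrestr setTI (le_lt_trans (probability_le1 _ _))// ltry.
- move=> B1 B2 mB1 mB2; rewrite /= /mrestr /mscale -QA setIC rect//.
  have := rect 0 setT B1 B2 (lexx _) (filtrationT (lexx _)) mB1 mB2.
  by rewrite setTI probability_setT mul1e => H; congr (_ * _)%E; exact: esym H.
Qed.

Lemma incr_max_law x e m B : 0 <= e -> measurable B ->
  P x [set w | B (incr_max (X ^~ w) e m 0)] = P 0 [set w | B (incr_max (X ^~ w) e m 0)].
Proof.
move=> e0 mB.
have := family_law hX x (A := [set f | B (incr_max f e m 0)]).
rewrite /= => ->; last first.
  have := @measurable_incr_max R _ path_space (fun t f => f t) e m 0 e0 (lexx _).
  move=> /(_ (@measurable_coordinate R)) /(_ measurableT B mB).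
  by rewrite setTI.
suff H f s : incr_max (fun t => x + f t) e m s = incr_max f e m s.
  by congr (P 0 _); apply/seteqP; split => w /=; rewrite H.
elim: m s => //= m IH s; rewrite IH; congr (Num.max _ (_ + _)); ring.
Qed.

Definition incr_sup t w u := running_sup (fun s => X (t + s) w - X t w) u.

Lemma right_continuous_shift t w : 0 <= t -> right_continuous (fun s => X (t + s) w).
Proof.
move=> t0 s s0; apply/cvgrPdist_lt => e e0.
have [e' e'0 H'] := right_continuous_dist (@levy_right_continuous w) (addr_ge0 t0 s0) e0.
near=> y; apply: H'; first by rewrite lerD2l.
rewrite -addrA ltrD2l; near: y.
by apply: nbhs_right_lt; rewrite ltrDl.
Unshelve. all: by end_near. Qed.

Lemma right_continuous_incr t w : 0 <= t ->
  right_continuous (fun s => X (t + s) w - X t w).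
Proof.
move=> t0 s s0; apply: cvgB; last exact: cvg_cst.
exact: right_continuous_shift.
Qed.

Lemma measurable_incr_sup t d' (S' : measurableType d') (g : S' -> T)
    (U : S' -> \bar R) : 0 <= t -> measurable_fun setT g -> measurable_fun setT U ->
  measurable_fun setT (fun z : S' => incr_sup t (g z) (U z)).
Proof.
move=> t0 mg mU.
apply: (@measurable_running_sup _ _ S' (fun s z => X (t + s) (g z) - X t (g z))) => //.
  move=> s s0; apply: measurable_funB; apply: measurableT_comp => //.
    by apply: levy_measurable; exact: addr_ge0.
  exact: levy_measurable.
by move=> w; exact: right_continuous_incr.
Qed.

(** The step [u * 2 ^- n] makes every grid end exactly at u, the only time from which
    right-continuity cannot move to a later grid point. *)
Lemma incr_sup_gt_grid t w (u a : R) : 0 <= t -> 0 <= u ->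
  (a%:E < incr_sup t w u%:E)%E <->
  exists n, a < incr_max (X ^~ w) (u * 2 ^- n) (2 ^ n) t.
Proof.
move=> t0 u0; rewrite running_sup_gtP; split; last first.
  case=> n /incr_max_gtP[i im H]; exists (i%:R * (u * 2 ^- n)); split => //.
    by rewrite !mulr_ge0// invr_ge0 exprn_ge0.
  rewrite lee_fin mulrCA mulrC -[leRHS]mul1r ler_wpM2r//.
  by rewrite ler_pdivrMr ?exprn_gt0// mul1r -natrX ler_nat.
case=> s [s0]; rewrite lee_fin le_eqVlt => /orP[/eqP -> H|su H].
  by exists 0%N; apply/incr_max_gtP; exists 1%N => //; rewrite mul1r expr0 invr1 mulr1.
have [h h0 hP] := right_continuous_gt (@right_continuous_incr t w t0) s0 H.
have u0' : 0 < u by exact: le_lt_trans su.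
have [n /(_ n (leqnn _)) ne] := @dyadic_small R (Num.min h (u - s) / u)
  ltac:(by rewrite divr_gt0// lt_min h0 subr_gt0).
move: ne; rewrite ltr_pdivlMr// lt_min => /andP[nd nus].
set i := (Num.truncn (s / u * 2 ^+ n)).+1.
have su0 : 0 <= s / u by rewrite divr_ge0.
have H1 : s < i%:R * (u * 2 ^- n).
  by rewrite mulrCA -ltr_pdivrMl// mulrC; exact: dyadic_ceil_gt.
have H2 : i%:R * (u * 2 ^- n) <= s + 2 ^- n * u.
  have := dyadic_ceil_le n su0.
  rewrite -(ler_pM2r u0') mulrDl mulfVK ?gt_eqF// /dyadic_ceil.
  by rewrite mulrAC mulrA.
exists n; apply/incr_max_gtP; exists i; last by apply: hP; lra.
have : i%:R * (u * 2 ^- n) <= u by lra.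
rewrite mulrCA -ler_pdivlMl// mulVf ?gt_eqF// ler_pdivrMr ?exprn_gt0// mul1r.
by rewrite -natrX ler_nat.
Qed.

Lemma independent_bigcup x t (A : set T) (U V : (set T)^nat) : measurable A ->
  (forall n, measurable (U n)) -> (forall n, measurable (V n)) ->
  nondecreasing_seq U -> nondecreasing_seq V ->
  (forall n, P x (A `&` U n) = P x A * P t (V n))%E ->
  (P x (A `&` \bigcup_n U n) = P x A * P t (\bigcup_n V n))%E.
Proof.
move=> mA mU mV ndU ndV UV.
have h1 : P x (A `&` U n) @[n --> \oo] --> P x (A `&` \bigcup_n U n).
  rewrite setI_bigcupr; apply: nondecreasing_cvg_mu.
  - by move=> n; exact: measurableI.
  - by apply: bigcup_measurable => n _; exact: measurableI.
  - by move=> n m nm; apply/subsetPset; apply: setIS; apply/subsetPset; exact: ndU.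
have h2 : (P x A * P t (V n))%E @[n --> \oo] --> (P x A * P t (\bigcup_n V n))%E.
  apply: cvgeZl; first by rewrite fin_num_measure.
  by apply: nondecreasing_cvg_mu => //; exact: bigcup_measurable.
rewrite -(cvg_lim (@ereal_hausdorff R) h1) -(cvg_lim (@ereal_hausdorff R) h2).
by under eq_fun do rewrite UV.
Qed.

(** Thanks to the strict inequality the event is an increasing union over dyadic grids when u is
    finite, and over integer horizons when u is [+oo]. The law of the increments depends neither on
    t nor on the starting point. *)
Lemma incr_sup_independent x t u (a : R) A : 0 <= t -> F t A ->
  (P x (A `&` [set w | a%:E < incr_sup t w u]) =
   P x A * P 0%R [set w | a%:E < incr_sup 0%R w u])%E.
Proof.
move=> t0 FA; have mA := levy_filtration_sub t0 FA.
have m_gt s (v : R) : 0 <= s -> measurable [set w | a%:E < incr_sup s w v%:E]%E.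
  move=> s0; have : measurable_fun setT (fun w => incr_sup s w v%:E).
    by apply: measurable_incr_sup => //; exact: measurable_id.
  move=> /(_ measurableT `]a%:E, +oo[%classic (emeasurable_itv _)).
  rewrite setTI; congr measurable; apply/seteqP; split => w /=.
    by rewrite in_itv/= andbT.
  by rewrite in_itv/= andbT.
have fin (v : R) : 0 <= v -> (P x (A `&` [set w | a%:E < incr_sup t w v%:E]) =
    P x A * P 0%R [set w | a%:E < incr_sup 0%R w v%:E])%E.
  move=> v0.
  have E s : 0 <= s -> [set w | a%:E < incr_sup s w v%:E]%E =
      \bigcup_n [set w | `]a, +oo[%classic (incr_max (X ^~ w) (v * 2 ^- n) (2 ^ n) s)].
    move=> s0; apply/seteqP; split => w /=.
      move=> /incr_sup_gt_grid -[]// n H; exists n => //=.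
      by rewrite in_itv/= andbT.
    case=> n _ /=; rewrite in_itv/= andbT => H.
    by apply/incr_sup_gt_grid => //; exists n.
  have v0' n : 0 <= v * 2 ^- n by rewrite mulr_ge0// invr_ge0 exprn_ge0.
  have mI s n : 0 <= s -> measurable
      [set w | `]a, +oo[%classic (incr_max (X ^~ w) (v * 2 ^- n) (2 ^ n) s)].
    move=> s0; rewrite -[X in measurable X]setTI.
    by apply: (@measurable_incr_max R d T X) => //; exact: levy_measurable.
  have ndI s : nondecreasing_seq (fun n =>
      [set w | `]a, +oo[%classic (incr_max (X ^~ w) (v * 2 ^- n) (2 ^ n) s)]).
    move=> m n mn; apply/subsetPset => w /=; rewrite !in_itv/= !andbT.
    exact: (@incr_max_nondecreasing R (X ^~ w) v s a v0 _ _ mn tt).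
  rewrite !E//; apply: independent_bigcup => // n; [exact: mI|exact: mI|].
  rewrite incr_max_independent//; congr (_ * _)%E.
  by apply: incr_max_law => //.
case: u => [u| |].
- have [u0|u0] := leP 0 u; first exact: fin.
  suff E s : [set w | a%:E < incr_sup s w u%:E]%E = set0.
    by rewrite !E setI0 !measure0 mule0.
  apply/seteqP; split => w //= /running_sup_gtP[v [v0]]; rewrite lee_fin.
  by move=> vu; move: (le_trans v0 vu); rewrite leNgt u0.
- have E s : 0 <= s -> [set w | a%:E < incr_sup s w +oo]%E =
      \bigcup_n [set w | a%:E < incr_sup s w n%:R%:E]%E.
    move=> s0; apply/seteqP; split => w /=.
      case/running_sup_gtP => v [v0 _ H]; exists (Num.truncn v).+1 => //=.
      apply/running_sup_gtP; exists v; split => //; rewrite lee_fin ltW//.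
      exact: Num.Theory.truncnS_gt.
    case=> n _ /= H; apply: (lt_le_trans H); apply: le_running_sup.
    exact: leey.
  have nd s : nondecreasing_seq (fun n => [set w | a%:E < incr_sup s w n%:R%:E]%E).
    move=> m n mn; apply/subsetPset => w /= H; apply: (lt_le_trans H).
    by apply: le_running_sup; rewrite lee_fin ler_nat.
  rewrite !E//; apply: independent_bigcup => // n; [exact: m_gt|exact: m_gt|].
  exact: fin.
- suff E s : [set w | a%:E < incr_sup s w -oo]%E = set0.
    by rewrite !E setI0 !measure0 mule0.
  by apply/seteqP; split => w //= /running_sup_gtP[v [v0]].
Qed.

(** * The hitting time is a stopping time *)

(** A strong Markov estimate for countably many times: the event that V is first entered at index k
    belongs to [F (t k)], so the bound applies to it; these events are disjoint and their
    probabilities add up. *)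
Lemma first_entry_bound x (t : nat -> R) (V E : nat -> set T) (c : R) :
  (forall k, 0 <= t k) -> {homo t : i k / (i <= k)%N >-> i <= k} ->
  (forall k, F (t k) (V k)) -> (forall k, measurable (E k)) -> 0 <= c ->
  (forall k A, F (t k) A -> P x (A `&` E k) <= c%:E * P x A)%E ->
  (P x (\bigcup_k (seqDU V k `&` E k)) <= c%:E * P x (\bigcup_k V k))%E.
Proof.
move=> t0 tmono FV mE c0 bound.
have FD k : F (t k) (seqDU V k).
  rewrite -filtration_measurableE//; apply: measurableD.
    by rewrite filtration_measurableE.
  apply: bigsetU_measurable => i _; rewrite filtration_measurableE//.
  by apply: levy_filtration_mono (FV i) => //; apply: tmono; exact/ltnW/ltn_ord.
have mD k := levy_filtration_sub (t0 k) (FD k).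
rewrite measure_bigcup//; last 2 first.
- by move=> k _; exact: measurableI.
- apply/trivIsetP => i j _ _ ij.
  have /trivIsetP/(_ i j Logic.I Logic.I ij) := trivIset_seqDU V.
  by move=> DI; rewrite setIACA DI set0I.
rewrite seqDU_bigcup_eq measure_bigcup; [|by move=> k _; exact: mD|exact: trivIset_seqDU].
rewrite -nneseriesZl//.
by apply: lee_nneseries => // k _; exact: bound.
Qed.

(** By right-continuity at 0 no path makes such a drop for arbitrarily large j, so the upper limit
    of the events is empty. *)
Lemma incr_lt_cvg0 x a : 0 < a ->
  (P x [set w | X j.+1%:R^-1 w - X 0 w < - a]%R) @[j --> \oo] --> 0%E.
Proof.
move=> a0.
pose Q j := [set w | X j.+1%:R^-1 w - X 0 w < - a]%R.
have mQ j : measurable (Q j).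
  have : measurable_fun setT (fun w => X j.+1%:R^-1 w - X 0 w).
    by apply: measurable_funB; exact: levy_measurable.
  move=> /(_ measurableT `]-oo, - a[%classic (measurable_itv _)); rewrite setTI.
  by congr measurable; apply/seteqP; split => w /=; rewrite in_itv.
pose U j := \bigcup_(k in [set k | (j <= k)%N]) Q k.
have mU j : measurable (U j) by exact: bigcup_measurable.
have cvgU : P x (U j) @[j --> \oo] --> P x (\bigcap_j U j).
  apply: nonincreasing_cvg_mu => //.
  - by rewrite (le_lt_trans (probability_le1 _ _))// ltry.
  - exact: bigcap_measurable.
  - move=> i j ij; apply/subsetPset => w [k /= jk Qk]; exists k => //=.
    exact: leq_trans jk.
rewrite [X in _ --> P x X](_ : _ = set0) ?measure0 in cvgU; last first.
  apply/seteqP; split => // w Hw.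
  have [D D0 DP] := right_continuous_gt (a := X 0 w - a) (@levy_right_continuous w) (lexx 0)
    ltac:(by rewrite ltrBlDr ltrDl).
  have [j jD] := invS_lt D0.
  have [k /= jk] := Hw j Logic.I; rewrite /Q /=.
  have : k.+1%:R^-1 <= j.+1%:R^-1 :> R by rewrite lef_pV2 ?posrE ?ltr0n// ler_nat.
  move=> kj; have := DP k.+1%:R^-1; rewrite invr_ge0 ler0n add0r => /(_ isT).
  by move=> /(_ (le_lt_trans kj jD)); lra.
apply: (@squeeze_cvge _ _ _ _ (cst 0%E) _ (fun j => P x (U j))) => //; last exact: cvg_cst.
apply: nearW => j; rewrite measure_ge0/=; apply: le_measure; rewrite ?inE//.
  exact: mQ.
by move=> w Qw; exists j => /=.
Qed.

(* After the first time of a fine grid at which X comes close to xs, X would have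
   to drop by a fixed amount within an arbitrarily short time; at a stopping time
   this has a probability tending to 0. *)
Lemma creeping_negligible x xs t : 0 <= t ->
  (P x).-negligible [set w | (forall s, 0 <= s -> s <= t -> X s w < xs) /\
    (forall n : nat, exists s, [/\ 0 <= s, s <= t & xs - n.+1%:R^-1 < X s w])].
Proof.
move=> t0.
pose tk (m k : nat) : R := k%:R * 2 ^- m.
have tk0 m k : 0 <= tk m k by rewrite mulr_ge0// invr_ge0 exprn_ge0.
have tkmono m : {homo tk m : i k / (i <= k)%N >-> i <= k}.
  by move=> i k ik; rewrite ler_wpM2r ?invr_ge0 ?exprn_ge0// ler_nat.
pose V n m k := [set w | xs - n.+1%:R^-1 < X (tk m k) w].
pose E i j m k := [set w | X (tk m k + j.+1%:R^-1) w - X (tk m k) w < - i.+1%:R^-1]%R.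
pose C i j n m := \bigcup_k (seqDU (V n m) k `&` E i j m k).
pose Q (i j : nat) := [set w | X j.+1%:R^-1 w - X 0 w < - i.+1%:R^-1]%R.
have mQ i j : measurable (Q i j).
  have j0 : 0 <= j.+1%:R^-1 :> R by rewrite invr_ge0.
  have := @filtration_incr 0 _ `]-oo, (- i.+1%:R^-1)[%classic (lexx 0) j0 (measurable_itv _).
  exact: levy_filtration_sub.
pose phi i j := P x (Q i j).
have FV n m k : F (tk m k) (V n m k).
  have := @levy_filtration_measurable (tk m k) (tk m k) (tk0 _ _) (lexx _) measurableT
    `]xs - n.+1%:R^-1, +oo[%classic (measurable_itv _).
  rewrite setTI filtration_measurableE//; congr (F _ _).
  by apply/seteqP; split => w /=; rewrite in_itv/= andbT.
have mV n m k := levy_filtration_sub (tk0 m k) (FV n m k).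
have EE i j m k : E i j m k =
    [set w | `]-oo, (- i.+1%:R^-1)[%classic (X (tk m k + j.+1%:R^-1) w - X (tk m k) w)%R].
  by apply/seteqP; split => w /=; rewrite in_itv.
have mE i j m k : measurable (E i j m k).
  have tj : 0 <= tk m k + j.+1%:R^-1 by rewrite addr_ge0.
  rewrite EE; apply: (levy_filtration_sub tj).
  by apply: filtration_incr => //; rewrite lerDl.
have mC i j n m : measurable (C i j n m).
  apply: bigcup_measurable => k _; apply: measurableI => //.
  by apply: measurableD => //; exact: bigsetU_measurable.
have PC i j n m : (P x (C i j n m) <= phi i j)%E.
  have phiE : phi i j = (fine (phi i j))%:E.
    by rewrite fineK// fin_num_measure.
  have phi0 : 0 <= fine (phi i j) by exact: fine_ge0.
  apply: (le_trans (@first_entry_bound x (tk m) (V n m) (E i j m) (fine (phi i j))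
    _ _ _ _ _ _)) => //.
    move=> k A FA; rewrite -phiE EE (levy_independent_increments (family_levy hX x))//; last first.
      by rewrite lerDl.
    rewrite (levy_stationary_increments (family_levy hX x))//; last by rewrite lerDl.
    rewrite muleC (_ : tk m k + j.+1%:R^-1 - tk m k = j.+1%:R^-1); last by ring.
    by rewrite (_ : [set w | _] = Q i j).
  rewrite -phiE -[leRHS]mule1; apply: lee_wpmul2l => //; apply: probability_le1.
  exact: bigcup_measurable.
pose liminf (G : (set T)^nat) := \bigcup_n \bigcap_(k in [set k | (n <= k)%N]) G k.
have mliminf G : (forall n, measurable (G n)) -> measurable (liminf G).
  by move=> mG; apply: bigcup_measurable => n _; exact: bigcap_measurableType.
(* The lower limits in m and n, and later in j, mirror the nested quantifiers of [left_approach].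
   The bound [phi i j] does not involve n or m, so it survives the first two limits, and it tends to
   0 with j. *)
pose D i j := liminf (fun n => liminf (C i j n)).
have mD i j : measurable (D i j) by apply: (mliminf) => n; exact: mliminf.
have PD i j : (P x (D i j) <= phi i j)%E.
  apply: measure_liminf_le => n; first exact: mliminf.
  by apply: measure_liminf_le => m; [exact: mC|exact: PC].
exists (\bigcup_i liminf (D i)); split.
- by apply: bigcup_measurable => i _; exact: mliminf.
- apply/eqP; rewrite -measure_le0.
  apply: (le_trans (measure_sigma_subadditive _ _ _ (@subset_refl _ _))) => //.
  + by move=> i; exact: mliminf.
  + by apply: bigcup_measurable => i _; exact: mliminf.
  rewrite eseries0// => i _ _; apply/eqP; rewrite -measure_le0.
  apply: (le_trans (measure_sigma_subadditive _ _ _ (@subset_refl _ _))) => //.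
  + by move=> n; exact: bigcap_measurableType.
  + exact: mliminf.
  rewrite eseries0// => n _ _; apply/eqP; rewrite -measure_le0.
  have ci : phi i j @[j --> \oo] --> 0%E by apply: incr_lt_cvg0; rewrite invr_gt0 ltr0n.
  rewrite -(cvg_lim (@ereal_hausdorff R) ci); apply: lime_ge.
    by apply/cvg_ex; exists 0%E.
  near=> j; apply: le_trans (PD i j); apply: le_measure; rewrite ?inE//.
    exact: bigcap_measurableType.
  by move=> w; apply => /=; near: j; exact: nbhs_infty_ge.
- move=> w [Hlt Hgt].
  have [i [j0 H]] := @left_approach R (fun n => n.+1%:R^-1) (X ^~ w) xs t
    ltac:(by move=> n; rewrite invr_gt0 ltr0n)
    ltac:(by move=> n n' nn'; rewrite lef_pV2 ?posrE ?ltr0n// ler_nat)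
    (@invS_lt R) (@levy_right_continuous w) t0 Hlt Hgt.
  exists i => //; exists j0 => // j /= /H[n0 {}H]; exists n0 => // n /= /H[m0 {}H].
  exists m0 => // m /= /H[k [kP kmin kE]]; exists k => //.
  by split => //; apply/seqDUP; split.
Unshelve. all: by end_near. Qed.

(** The infimum is attained: if X stayed below xs on [0, t], right-continuity at t would keep it
    below on a further interval, and the hitting time would exceed t. *)
Lemma hitting_time_leP xs t w : 0 <= t ->
  (hitting_time X xs w <= t%:E)%E <-> exists s, [/\ 0 <= s, s <= t & xs <= X s w].
Proof.
move=> t0; split; last first.
  case=> s [s0 st Xs]; apply: (@le_trans _ _ s%:E); last by rewrite lee_fin.
  by apply: ereal_inf_lbound; exists s.
move=> H; apply: contrapT => /forallNP N.
have lt s : 0 <= s -> s <= t -> X s w < xs.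
  by move=> s0 st; rewrite ltNge; apply/negP => Xs; apply: (N s).
have [D D0 DP] := right_continuous_lt (@levy_right_continuous w) t0 (lt t t0 (lexx _)).
have : ((t + D)%:E <= hitting_time X xs w)%E.
  apply: le_ereal_inf_tmp => _ [s [s0 Xs] <-]; rewrite lee_fin leNgt; apply/negP => stD.
  have [ts|ts] := leP t s; first by have := DP s ts stD; rewrite ltNge Xs.
  by have := lt s s0 (ltW ts); rewrite ltNge Xs.
by move=> /le_trans /(_ H); rewrite lee_fin; lra.
Qed.

(** Right-continuity moves an exceedance to a rational time before t, except one at t itself: later
    times are unknown to [F t], so the event at t is added separately. *)
Lemma filtration_sup_gt s0 t a : 0 <= s0 -> s0 <= t ->
  F t [set w | exists s, [/\ s0 <= s, s <= t & a < X s w]].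
Proof.
move=> s00 s0t; have t0 := le_trans s00 s0t.
have FX s : 0 <= s -> s <= t ->
    measurable ([set w | a < X s w] : set (g_sigma_algebraType (F t))).
  move=> s'0 st; have := @levy_filtration_measurable s t s'0 st measurableT
    `]a, +oo[%classic (measurable_itv _).
  rewrite setTI; congr measurable.
  by apply/seteqP; split => w /=; rewrite in_itv/= andbT.
rewrite -filtration_measurableE//.
rewrite (_ : [set w | _] = [set w | a < X t w] `|` \bigcup_(q : rat)
  (if (s0 <= ratr q) && (ratr q <= t) then [set w | a < X (ratr q) w] else set0)).
  apply: measurableU; first exact: FX.
  apply: bigcupT_measurable_rat => q; case: ifPn => // /andP[q0 qt].
  by apply: FX => //; exact: le_trans q0.
apply/seteqP; split => w /=.
  case=> s [s0s]; rewrite le_eqVlt => /orP[/eqP ->|st Xs]; first by left.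
  right; have [D D0 DP] := right_continuous_gt (@levy_right_continuous w)
    (le_trans s00 s0s) Xs.
  have [|q] := @rat_in_itvoo _ s (Num.min t (s + D)).
    by rewrite lt_min st ltrDl.
  rewrite in_itv/= lt_min => /and3P[sq qt qD]; exists q => //.
  by rewrite (le_trans s0s (ltW sq)) (ltW qt)/=; apply: DP => //; exact: ltW.
case=> [Xt|[q _]]; first by exists t.
by case: ifPn => // /andP[q0 qt] Xq; exists (ratr q).
Qed.

(** [A] says that X comes arbitrarily close to xs, or above, before t. It exceeds the event of a hit
    exactly by [N], which is null under every [P x]. *)
Lemma hitting_time_stopping xs : stopping_time F (hitting_time X xs).
Proof.
split=> [w|t t0].
  by apply: le_ereal_inf_tmp => _ [s [s0 _] <-]; rewrite lee_fin.
pose A := \bigcap_(n : nat) [set w | exists s, [/\ 0 <= s, s <= t & xs - n.+1%:R^-1 < X s w]].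
pose N := [set w | (forall s, 0 <= s -> s <= t -> X s w < xs) /\
    (forall n : nat, exists s, [/\ 0 <= s, s <= t & xs - n.+1%:R^-1 < X s w])].
have FN : F t N.
  apply: (levy_filtration_mono (lexx 0)) => //.
  by apply: (filtration_complete (family_usual hX)) => x; exact: creeping_negligible.
rewrite (_ : [set w | _] = A `\` N).
  rewrite -filtration_measurableE//; apply: measurableD.
    by apply: bigcapT_measurable => n; rewrite filtration_measurableE//; exact: filtration_sup_gt.
  by rewrite filtration_measurableE.
apply/seteqP; split => w /=.
  move/(hitting_time_leP _ _ t0) => [s [s0 st Xs]]; split.
    move=> n _; exists s; split => //; apply: lt_le_trans Xs.
    by rewrite ltrBlDr ltrDl invr_gt0 ltr0n.
  by case=> /(_ s s0 st); rewrite ltNge Xs.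
case=> Aw Nw; apply/(hitting_time_leP _ _ t0).
apply: contrapT => /forallNP H; apply: Nw; split; last by move=> n; exact: Aw.
by move=> s s0 st; rewrite ltNge; apply/negP => Xs; apply: (H s).
Qed.

(** * The process at infinity for a null rate *)

(* From each late time at which X exceeds c, X rises by a further a with
   probability at least rho > 0, independently of the past; hence the probability
   q of the event satisfies q <= (1 - rho) q. *)
Lemma overshoot_negligible x a c (N : nat) : 0 < a ->
  (0 < P 0%R [set w | a%:E < incr_sup 0%R w +oo])%E ->
  (P x).-negligible [set w | (forall n : nat, exists2 s, n%:R <= s & c < X s w) /\
    forall s, N%:R <= s -> X s w <= c + a].
Proof.
move=> a0; set rho := P 0 _ => rho0.
have mJ t : 0 <= t -> measurable [set w | a%:E < incr_sup t w +oo]%E.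
  move=> t0; have mI : measurable_fun setT (fun w => incr_sup t w +oo%E).
    by apply: measurable_incr_sup => //; exact: measurable_id.
  have := mI measurableT `]a%:E, +oo[%classic (emeasurable_itv _).
  by rewrite setTI; congr measurable; apply/seteqP; split => w /=; rewrite in_itv/= andbT.
have rhoE : rho = (fine rho)%:E by rewrite fineK// fin_num_measure//; exact: mJ.
have rho1 : fine rho <= 1.
  by rewrite -lee_fin -rhoE; apply: probability_le1; exact: mJ.
pose Ex (M : nat) b := [set w | exists2 s, M%:R <= s & b < X s w].
have ExE M b : Ex M b = \bigcup_(k : nat)
    [set w | exists s, [/\ M%:R <= s, s <= (M + k)%:R & b < X s w]].
  apply/seteqP; split => w /=.
    case=> s Ms bX; exists (Num.truncn s).+1 => //; exists s; split => //.
    apply: (le_trans (ltW (Num.Theory.truncnS_gt s))).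
    by rewrite ler_nat; exact: leq_addl.
  by case=> k _ [s [Ms _ bX]]; exists s.
have mEx M b : measurable (Ex M b).
  rewrite ExE; apply: bigcup_measurable => k _.
  have Mk : 0 <= (M + k)%:R :> R by [].
  by apply: (levy_filtration_sub Mk); apply: filtration_sup_gt => //; rewrite ler_nat leq_addr.
(* [UB M] is the part of the bound [B] already visible at time M. Unlike [B], it may serve as part
   of an event of the past. *)
pose UB (M : nat) := [set w | forall s, N%:R <= s -> s <= M%:R -> X s w <= c + a].
have FUB M : (N <= M)%N -> F M%:R (UB M).
  move=> NM; rewrite (_ : UB M = ~` [set w | exists s, [/\ N%:R <= s, s <= M%:R & c + a < X s w]]).
    rewrite -filtration_measurableE//; apply: measurableC.
    by rewrite filtration_measurableE//; apply: filtration_sup_gt => //; rewrite ler_nat.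
  apply/seteqP; split => w /=.
    by move=> H [s [Ns sM]]; rewrite ltNge H.
  by move=> /forallNP H s Ns sM; rewrite leNgt; apply/negP => Xs; apply: (H s).
have mUB M : (N <= M)%N -> measurable (UB M).
  by move=> /FUB; apply: levy_filtration_sub.
pose B := [set w | forall s, N%:R <= s -> X s w <= c + a].
have mB : measurable B.
  rewrite (_ : B = ~` Ex N (c + a)); first exact: measurableC.
  apply/seteqP; split => w /=; first by move=> H [s Ns]; rewrite ltNge H.
  by move=> H s Ns; rewrite leNgt; apply/negP => Xs; apply: H; exists s.
have step M : (N <= M)%N ->
    (P x (Ex M c `&` B) <= (1 - fine rho)%:E * P x (Ex M c `&` UB M))%E.
  move=> NM.
  pose tk (m k : nat) : R := k%:R * 2 ^- m.
  have tk0 m k : 0 <= tk m k by rewrite mulr_ge0// invr_ge0 exprn_ge0.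
  have tkmono m : {homo tk m : i k / (i <= k)%N >-> i <= k}.
    by move=> i k ik; rewrite ler_wpM2r ?invr_ge0 ?exprn_ge0// ler_nat.
  pose V m k := if M%:R <= tk m k then [set w | c < X (tk m k) w] `&` UB M else set0.
  pose E m k := [set w | incr_sup (tk m k) w +oo <= a%:E]%E.
  have EC m k : E m k = ~` [set w | a%:E < incr_sup (tk m k) w +oo]%E.
    by apply/seteqP; split => w; rewrite /E /= leNgt => /negP.
  have mE m k : measurable (E m k) by rewrite EC; apply: measurableC; exact: mJ.
  have FV m k : F (tk m k) (V m k).
    rewrite /V; case: ifPn => [Mt|_]; last first.
      by rewrite -filtration_measurableE//; exact: measurable0.
    apply: filtrationI => //; last first.
      by apply: levy_filtration_mono (FUB M NM).
    have := @levy_filtration_measurable (tk m k) (tk m k) (tk0 _ _) (lexx _) measurableT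
      `]c, +oo[%classic (measurable_itv _).
    rewrite setTI filtration_measurableE//; congr (F _ _).
    by apply/seteqP; split => w /=; rewrite in_itv/= andbT.
  have mV m k := levy_filtration_sub (tk0 m k) (FV m k).
  have PE m : (P x (\bigcup_k (seqDU (V m) k `&` E m k)) <=
      (1 - fine rho)%:E * P x (Ex M c `&` UB M))%E.
    apply: (le_trans (@first_entry_bound x (tk m) (V m) (E m) (1 - fine rho) _ _ _ _ _ _)) => //.
    - by rewrite subr_ge0.
    - move=> k A FA; have mA := levy_filtration_sub (tk0 m k) FA.
      rewrite EC -setDE measureD//; last 2 first.
        exact: mJ.
        by rewrite (le_lt_trans (probability_le1 _ _))// ltry.
      rewrite [X in (_ - X)%E](@incr_sup_independent x (tk m k) +oo%E a A (tk0 m k) FA).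
      have PA : P x A = (fine (P x A))%:E by rewrite fineK// fin_num_measure.
      rewrite -/rho [X in (X - _)%E]PA PA rhoE -!EFinM -EFinB lee_fin; lra.
    - apply: lee_wpmul2l; first by rewrite lee_fin subr_ge0.
      apply: le_measure; rewrite ?inE; first exact: bigcup_measurable.
        by apply: measurableI => //; exact: mUB.
      move=> w [k _]; rewrite /V; case: ifPn => // Mt [cX Uw]; split => //.
      by exists (tk m k).
  pose G m := \bigcup_k (seqDU (V m) k `&` E m k).
  have mG m : measurable (G m).
    apply: bigcup_measurable => k _; apply: measurableI => //.
    by apply: measurableD => //; exact: bigsetU_measurable.
  apply: (le_trans _ (measure_liminf_le mG PE)); apply: le_measure; rewrite ?inE.
  - exact: measurableI.
  - by apply: bigcup_measurable => n _; exact: bigcap_measurableType.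
  move=> w [[s Ms cX] Bw].
  have s0 : 0 <= s by apply: le_trans Ms.
  have [D D0 DP] := right_continuous_gt (@levy_right_continuous w) s0 cX.
  have [m0 m0P] := dyadic_small D0.
  exists m0 => // m /= /m0P mD.
  have ex : exists k, `[< V m k w >].
    exists (Num.truncn (s * 2 ^+ m)).+1; apply/asboolP; rewrite /V /tk.
    have := dyadic_ceil_gt m s0; have := dyadic_ceil_le m s0.
    rewrite -/(dyadic_ceil m s) => sD sgt.
    rewrite (le_trans Ms (ltW sgt)); split.
      by apply: DP; lra.
    by move=> s' Ns' _; exact: Bw.
  have [k /asboolP Vk kmin] := ex_minnP ex.
  exists k => //; split.
    apply/seqDUP; split => // i ik Vi.
    by have := kmin i; rewrite leqNgt ik => /(_ (asboolT Vi)).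
  rewrite /E /= leNgt; apply/negP => /running_sup_gtP[v [v0 _]].
  move: Vk; rewrite /V; case: ifPn => // Mt [cXt _].
  have : N%:R <= tk m k + v.
    by rewrite (le_trans _ (le_trans Mt _)) ?ler_nat// lerDl.
  by move=> /Bw; rewrite /= in cXt; lra.
have mI : measurable (\bigcap_(M : nat) (Ex (N + M) c `&` B)).
  by apply: bigcapT_measurable => M; exact: measurableI.
exists (\bigcap_(M : nat) (Ex (N + M) c `&` B)); split => //; last first.
  by move=> w [io ub] M _; split => //; exact: io.
set I := \bigcap_(M : nat) _ in mI *.
(* As M grows, [UB] shrinks to [B], so the right-hand side of [step] tends to a multiple of the
   probability of the very event [I] that its left-hand side contains. *)
have cvgI : P x (Ex (N + M) c `&` UB (N + M)%N) @[M --> \oo] --> P x I.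
  rewrite (_ : I = \bigcap_M (Ex (N + M) c `&` UB (N + M)%N)).
    apply: nonincreasing_cvg_mu.
    - rewrite (le_lt_trans (probability_le1 _ _))// ?ltry//.
      by apply: measurableI => //; apply: mUB; exact: leq_addr.
    - by move=> M; apply: measurableI => //; apply: mUB; exact: leq_addr.
    - by apply: bigcapT_measurable => M; apply: measurableI => //; apply: mUB; exact: leq_addr.
    - move=> i j ij; apply/subsetPset => w [[s js cX] Uj]; split.
        by exists s => //; apply: le_trans js; rewrite ler_nat leq_add2l.
      move=> s' Ns' s'i; apply: Uj => //; apply: le_trans s'i _.
      by rewrite ler_nat leq_add2l.
  apply/seteqP; split => w Iw M _.
    by have [Ew Bw] := Iw M Logic.I; split => // s Ns _; exact: Bw.
  have [Ew _] := Iw M Logic.I; split => // s Ns.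
  have [_] := Iw (Num.truncn s).+1 Logic.I; apply => //.
  apply: (le_trans (ltW (Num.Theory.truncnS_gt s))).
  by rewrite ler_nat leq_addl.
have le1 : (P x I <= (1 - fine rho)%:E * P x I)%E.
  have cvg2 : ((1 - fine rho)%:E * P x (Ex (N + M)%N c `&` UB (N + M)%N))%E @[M --> \oo] -->
      ((1 - fine rho)%:E * P x I)%E by exact: cvgeZl.
  rewrite -(cvg_lim (@ereal_hausdorff R) cvg2); apply: lime_ge.
    by apply/cvg_ex; eexists; exact: cvg2.
  apply: nearW => M; apply: (le_trans _ (step _ (leq_addr _ _))).
  apply: le_measure; rewrite ?inE//; first exact: measurableI.
  by move=> w; apply.
have PIfin : P x I \is a fin_num by rewrite fin_num_measure.
have rr0 : 0 < fine rho by rewrite -lte_fin -rhoE.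
apply/eqP; rewrite eq_le measure_ge0 andbT.
move: le1; rewrite -(fineK PIfin) -EFinM !lee_fin => le1.
rewrite -(@pmulr_rle0 _ (fine rho))//; lra.
Qed.

(** Some rise a > 0 has positive probability. If X exceeds 0 at arbitrarily late times,
    [overshoot_negligible] lifts this from level k a to level (k + 1) a, for all k, almost surely;
    then the supremum is infinite. *)
Lemma levy_eventually_le0 x :
  {ae P x, forall w, running_sup (X ^~ w) +oo \is a fin_num} ->
  (0 < P 0%R [set w | 0 < incr_sup 0%R w +oo])%E ->
  {ae P x, forall w, exists N : nat, forall s, N%:R <= s -> X s w <= 0}.
Proof.
move=> Mfin pos.
have [a a0 rho0] : exists2 a, 0 < a & (0 < P 0%R [set w | a%:E < incr_sup 0%R w +oo])%E.
  apply: contrapT => /forall2NP H.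
  have mI : measurable_fun setT (fun w => incr_sup 0 w +oo%E).
    by apply: measurable_incr_sup => //; exact: measurable_id.
  have mJ b : measurable [set w | b%:E < incr_sup 0 w +oo]%E.
    have := mI measurableT `]b%:E, +oo[%classic (emeasurable_itv _).
    by rewrite setTI; congr measurable; apply/seteqP; split => w /=; rewrite in_itv/= andbT.
  move: pos; apply/negP; rewrite -leNgt.
  rewrite (_ : [set w | _] = \bigcup_n [set w | n.+1%:R^-1%:E < incr_sup 0 w +oo]%E).
    apply: (le_trans (measure_sigma_subadditive _ _ _ (@subset_refl _ _))) => //.
      by apply: bigcup_measurable => n _; exact: mJ.
    rewrite eseries0// => n _ _; apply/eqP; rewrite -measure_le0 leNgt; apply/negP => Pn.
    by have [|] := H n.+1%:R^-1; rewrite ?invr_gt0 ?ltr0n.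
  apply/seteqP; split => w /=.
    move=> /running_sup_gtP[s [s0 _ H']]; have [n nX] := invS_lt H'.
    by exists n => //=; apply/running_sup_gtP; exists s; rewrite s0 leey.
  by case=> n _ /=; apply: lt_trans; rewrite lte_fin invr_gt0 ltr0n.
have Z := fun k N => overshoot_negligible x (k%:R * a) N a0 rho0.
have Z' := negligible_bigcup (fun k => negligible_bigcup (Z k)).
have := negligibleU Z' Mfin; apply: negligibleS => w /= Hw.
have io0 n : exists2 s, n%:R <= s & 0 < X s w.
  apply: contrapT => /forall2NP H; apply: Hw; exists n => s ns; rewrite leNgt; apply/negP => Xs.
  by have [] := H s.
have [[k _ [N _ H]]|nZ] := pselect ((\bigcup_k \bigcup_N [set w |
    (forall n : nat, exists2 s, n%:R <= s & k%:R * a < X s w) /\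
    forall s, N%:R <= s -> X s w <= k%:R * a + a]) w).
  by left; exists k => //; exists N.
right => Mw.
have io k n : exists2 s, n%:R <= s & k%:R * a < X s w.
  elim: k n => [|k IH] n; first by rewrite mul0r; exact: io0.
  apply: contrapT => /forall2NP H; apply: nZ; exists k => //; exists n => //; split => // s ns.
  have -> : k%:R * a + a = k.+1%:R * a by rewrite -natr1; ring.
  by rewrite leNgt; apply/negP => Xs; have [] := H s.
have fin : (running_sup (X ^~ w) +oo < +oo)%E by rewrite ltey_eq Mw.
have [s _ Xs] := io (Num.truncn (fine (running_sup (X ^~ w) +oo) / a)).+1 0%N.
have [s' s'0 Xs'] := io (Num.truncn (fine (running_sup (X ^~ w) +oo) / a)).+1 0%N.
have := @running_sup_ge R (X ^~ w) +oo%E s' s'0 (leey _).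
rewrite -(fineK Mw) lee_fin leNgt => /negP; apply.
apply: le_lt_trans Xs'; rewrite -ler_pdivrMr//; apply/ltW.
exact: Num.Theory.truncnS_gt.
Qed.

(** * The Markov property at the killing time *)

(* The killing time is independent of X but not necessarily of the filtration,
   so the process is studied on the product of T with the law of e. *)
Section killed_law.
Context (r : R) (e : T -> \bar R).
Hypotheses (he : killing_time P X r e) (r0 : 0 <= r).
Notation kap := (killing_law he).
Notation prodP x := (P x \x kap)%E.

Lemma measurable_levy_path d' (S' : measurableType d') (g : S' -> T) :
  measurable_fun setT g -> measurable_fun setT (fun z => X ^~ (g z) : path_space).
Proof.
move=> mg; apply: (@measurable_path _ _ S' (fun t z => X t (g z))) => t t0.
by apply: measurableT_comp => //; exact: levy_measurable.
Qed.

Lemma measurable_levy_running_sup d' (S' : measurableType d') (g : S' -> T)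
    (U : S' -> \bar R) :
  measurable_fun setT g -> measurable_fun setT U ->
  measurable_fun setT (fun z => running_sup (X ^~ (g z)) (U z)).
Proof.
move=> mg mU; apply: (@measurable_running_sup _ _ S' (fun s z => X s (g z))) => //.
  move=> s s0; apply: measurableT_comp => //; exact: levy_measurable.
by move=> z; exact: levy_right_continuous.
Qed.

Lemma killed_lawT x : prodP x setT = 1%E.
Proof.
rewrite -setXTT product_measure1E// -[RHS]mule1.
by congr (_ * _)%E; exact: probability_setT.
Qed.

(** By independence the pair of the path and e has the product law, and M is a function of this
    pair. *)
Lemma sup_until_law x B : measurable B ->
  P x (sup_until X e @^-1` B) =
  prodP x ((fun z => running_sup (X ^~ z.1) z.2) @^-1` B).
Proof.
have me := killing_measurable he.
apply: ereal_law_unique.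
- exact: (@measurable_levy_running_sup _ T idfun e (@measurable_id _ T setT)
    (killing_measurable he)).
- by apply: measurable_levy_running_sup.
- by rewrite [X in (X < _)%E](probability_setT (P x)) ltry.
- by rewrite [LHS](probability_setT (P x)) [RHS]killed_lawT.
move=> a.
(* [path_space] also contains paths that are not right-continuous. The rational description is
   measurable on all of them and agrees with the supremum on the paths of X. *)
pose D : set (path_space * \bar R) := [set z | running_sup_gt_rat a z.1 z.2].
have mD : measurable D.
  apply: (@measurable_running_sup_gt_rat _ _ (path_space * \bar R)%type
    (fun s z => z.1 s) snd) => // s s0.
  exact: (measurableT_comp (@measurable_coordinate R s s0) measurable_fst).
have E w u : (a%:E < running_sup (X ^~ w) u)%E <-> D (X ^~ w, u).
  by apply: running_sup_gt_ratP; exact: levy_right_continuous.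
transitivity (P x ((fun w => (X ^~ w : path_space, e w)) @^-1` D)).
  by congr (P x _); apply/seteqP; split => w /E.
transitivity (prodP x ((fun z => (X ^~ z.1 : path_space, z.2)) @^-1` D)); last first.
  by congr (prodP x _); apply/seteqP; split => -[w u] /E.
apply: pair_law_unique => //.
- apply: measurable_fun_pair => //.
  exact: (@measurable_levy_path _ T idfun (@measurable_id _ T setT)).
- by apply: measurable_fun_pair => //; exact: measurable_levy_path.
- by rewrite [X in (X < _)%E](probability_setT (P x)) ltry.
- move=> A C mA mC.
  have -> : (fun w => (X ^~ w : path_space, e w)) @^-1` (A `*` C) =
      [set w | A (fun t => X t w)] `&` e @^-1` C by [].
  apply: (eq_trans (killing_independent he x mA mC)); rewrite (killing_lawE he r0 x mC).
  have -> : (fun z : T * \bar R => (X ^~ z.1 : path_space, z.2)) @^-1` (A `*` C) =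
      [set w | A (fun t => X t w)] `*` C by [].
  rewrite [RHS]product_measure1E//.
  rewrite -[X in measurable X]setTI.
  exact: (@measurable_levy_path _ T idfun (@measurable_id _ T setT)).
Qed.

Lemma integral_sup_until x (H : \bar R -> \bar R) :
  measurable_fun setT H -> (forall u, 0 <= H u)%E ->
  (\int[P x]_w H (sup_until X e w) =
   \int[prodP x]_z H (running_sup (X ^~ z.1) z.2))%E.
Proof.
apply: ge0_integral_law_eq.
- exact: (@measurable_levy_running_sup _ T idfun e (@measurable_id _ T setT)
    (killing_measurable he)).
- by apply: measurable_levy_running_sup.
- exact: sup_until_law.
Qed.

Lemma killed_tonelli x (f : T * \bar R -> \bar R) :
  measurable_fun setT f -> (forall z, 0 <= f z)%E ->
  (\int[prodP x]_z f z = \int[P x]_w \int[kap]_u f (w, u))%E.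
Proof. exact: (@fubini_tonelli1 _ _ _ _ _ (P x) kap). Qed.

Lemma measurable_killed_integral (f : T * \bar R -> \bar R) :
  measurable_fun setT f -> (forall z, 0 <= f z)%E ->
  measurable_fun setT (fun w => \int[kap]_u f (w, u))%E.
Proof. exact: (@measurable_fun_fubini_tonelli_F _ _ _ _ _ kap). Qed.

Lemma measurable_incr_sup_prod t : 0 <= t ->
  measurable_fun setT (fun z : T * \bar R => incr_sup t z.1 z.2).
Proof. by move=> t0; exact: measurable_incr_sup. Qed.

(** For each fixed killing time u this is [incr_sup_independent]; Tonelli integrates it over u. *)
Lemma incr_sup_law x t A B : 0 <= t -> F t A -> measurable B ->
  (prodP x ((A `*` setT) `&` [set z | B (incr_sup t z.1 z.2)]) =
   P x A * prodP 0%R [set z | B (incr_sup 0%R z.1 z.2)])%E.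
Proof.
move=> t0 FA mB; have mA := levy_filtration_sub t0 FA.
have mAT : measurable (A `*` [set: \bar R]) by exact: measurableX.
have QA0 : 0 <= fine (P x A) by exact: fine_ge0.
pose c := NngNum QA0.
have QA : P x A = (c%:num)%:E by rewrite /= fineK ?fin_num_measure.
have m_gt s (a : R) : 0 <= s -> measurable [set z : T * \bar R | a%:E < incr_sup s z.1 z.2]%E.
  move=> s0; have := measurable_incr_sup_prod s0.
  move=> /(_ measurableT `]a%:E, +oo[%classic (emeasurable_itv _)).
  rewrite setTI; congr measurable; apply/seteqP; split => w /=.
    by rewrite in_itv/= andbT.
  by rewrite in_itv/= andbT.
rewrite setIC QA; apply: (@ereal_law_unique _ _ _ _ R (mrestr (prodP x) mAT)
  (mscale c (prodP 0)) (fun z => incr_sup t z.1 z.2) (fun z => incr_sup 0 z.1 z.2)) => //.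
- exact: measurable_incr_sup_prod.
- exact: measurable_incr_sup_prod.
- change (prodP x (setT `&` (A `*` setT)) < +oo)%E; rewrite setTI product_measure1E//.
  by rewrite [X in (_ * X)%E](probability_setT kap) mule1 [X in (X < _)%E]QA ltry.
- change (prodP x (setT `&` (A `*` setT)) = (c%:num)%:E * prodP 0%R setT)%E.
  rewrite setTI [LHS]product_measure1E//; congr (_ * _)%E; first exact: QA.
  by rewrite [RHS]killed_lawT; exact: probability_setT.
move=> a.
change (prodP x ([set z | a%:E < incr_sup t z.1 z.2] `&` (A `*` setT)) =
  (c%:num)%:E * prodP 0%R [set z | a%:E < incr_sup 0%R z.1 z.2])%E.
rewrite product_measure_ysection; last by apply: measurableI => //; exact: m_gt.
rewrite [X in (_ = _ * X)%E]product_measure_ysection; last exact: m_gt.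
rewrite -ge0_integralZl//; last first.
  exact: (@measurable_fun_ysection _ _ _ _ _ (P 0) _ (m_gt 0 a (lexx _))).
apply: eq_integral => u _ /=.
have -> : ysection ([set z | (a%:E < incr_sup t z.1 z.2)%E] `&` (A `*` setT)) u =
    A `&` [set w | a%:E < incr_sup t w u]%E.
  apply/seteqP; split => w; rewrite /ysection /= inE /=; first by case=> ? [].
  by case.
have -> : ysection [set z | (a%:E < incr_sup 0 z.1 z.2)%E] u =
    [set w | a%:E < incr_sup 0 w u]%E.
  by apply/seteqP; split => w; rewrite /ysection /= inE.
by rewrite incr_sup_independent//= QA.
Qed.

(** Since [X t] is known at time t, the condition that it lies in B1 can be absorbed into A. Thus on
    A the position and the later increments have a product law. *)
Lemma ge0_integral_incr_sup x t A (H : R * \bar R -> \bar R) : 0 <= t -> F t A ->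
  measurable_fun setT H -> (forall y, 0 <= H y)%E ->
  (\int[P x]_(w in A) \int[prodP 0%R]_z H (X t w, incr_sup 0%R z.1 z.2) =
   \int[P x]_(w in A) \int[kap]_u H (X t w, incr_sup t w u))%E.
Proof.
move=> t0 FA mH H0; have mA := levy_filtration_sub t0 FA.
have mAT : measurable (A `*` [set: \bar R]) by exact: measurableX.
have mAT' : measurable (A `*` [set: T * \bar R]) by exact: measurableX.
pose mu2 : probability (T * \bar R)%type R := (prodP 0)%E.
pose f1 (z : T * \bar R) := (X t z.1, incr_sup t z.1 z.2).
pose f2 (z : T * (T * \bar R)) := (X t z.1, incr_sup 0 z.2.1 z.2.2).
have mf1 : measurable_fun setT f1.
  apply: measurable_fun_pair; last exact: measurable_incr_sup_prod.
  by apply: measurableT_comp => //; exact: levy_measurable.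
have mf2 : measurable_fun setT f2.
  apply: measurable_fun_pair.
    by apply: measurableT_comp => //; exact: levy_measurable.
  by apply: measurable_incr_sup => //; exact: measurableT_comp.
have law D : measurable D -> mrestr (prodP x) mAT (f1 @^-1` D) =
    mrestr (P x \x mu2)%E mAT' (f2 @^-1` D).
  apply: (@pair_law_unique _ _ _ _ _ _ _ _ _ (mrestr (prodP x) mAT)
  (mrestr (P x \x mu2)%E mAT') f1 f2) => //.
    change (prodP x (setT `&` (A `*` setT)) < +oo)%E; rewrite setTI product_measure1E//.
    rewrite [X in (_ * X)%E](probability_setT kap) mule1.
    by rewrite (le_lt_trans (probability_le1 _ _))// ltry.
  move=> B1 B2 mB1 mB2; rewrite /= /mrestr.
  have FAB : F t (A `&` X t @^-1` B1).
    by apply: filtrationI => //; apply: (levy_adapted (family_levy hX 0)).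
  have mAB := levy_filtration_sub t0 FAB.
  have mB2' : measurable [set z : T * \bar R | B2 (incr_sup 0 z.1 z.2)].
    by have := @measurable_incr_sup_prod 0 (lexx _) measurableT B2 mB2; rewrite setTI.
  rewrite (_ : _ `&` _ = ((A `&` X t @^-1` B1) `*` setT) `&`
      [set z | B2 (incr_sup t z.1 z.2)]); last first.
    by apply/seteqP; split => -[w u] /=; [case=> -[? ?] [? ?]|case=> -[[? ?]] ? ?].
  rewrite [LHS]incr_sup_law//.
  rewrite (_ : _ `&` _ = ((A `&` X t @^-1` B1) `*` [set z | B2 (incr_sup 0 z.1 z.2)])).
    exact: (esym (@product_measure1E _ _ _ _ _ (P x) mu2 _ _ mAB mB2')).
  by apply/seteqP; split => -[w u] /=; [case=> -[? ?] [? ?]|case=> -[? ?] ?].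
have := ge0_integral_law_eq mf1 mf2 law mH H0.
have mHf1 : measurable_fun setT (fun z => H (f1 z)) by exact: measurableT_comp.
have mHf2 : measurable_fun setT (fun z => H (f2 z)) by exact: measurableT_comp.
rewrite !ge0_integral_mrestr//.
have tonelli d' (S' : measurableType d') (m : {sigma_finite_measure set S' -> \bar R})
    (f : T * S' -> \bar R) : measurable_fun setT f -> (forall z, 0 <= f z)%E ->
    (\int[P x \x m]_(z in A `*` setT) f z = \int[P x]_(w in A) \int[m]_y f (w, y))%E.
  move=> mf f0; rewrite integral_mkcond.
  rewrite (@fubini_tonelli1 _ _ _ _ _ (P x) m (f \_ (A `*` setT))); last 2 first.
  - by apply/measurable_restrict => //; [exact: measurableX|exact: measurable_funTS].
  - by move=> z; rewrite patchE; case: ifP.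
  rewrite [RHS]integral_mkcond; apply: eq_integral => w _.
  rewrite /fubini_F patchE; case: ifPn => wA.
    by apply: eq_integral => y _; rewrite patchE ifT// in_setX wA in_setT.
  apply: integral0_eq => y _; rewrite patchE ifF// in_setX.
  by rewrite (negbTE wA).
by rewrite (tonelli _ _ kap)// (tonelli _ _ mu2).
Qed.

Definition killed_expectation (H : \bar R -> \bar R) x : \bar R :=
  (\int[P x]_w H (sup_until X e w))%E.

(** Moves the starting point from the measure into the integrand, so that the value is a measurable
    function of it and [X t w] can be inserted. It is the Markov property at time 0, where X equals
    x almost surely. *)
Lemma killed_expectationE (H : \bar R -> \bar R) x :
  measurable_fun setT H -> (forall y, 0 <= H y)%E ->
  killed_expectation H x =
  (\int[prodP 0%R]_z H (x%:E + incr_sup 0%R z.1 z.2))%E.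
Proof.
move=> mH H0; rewrite /killed_expectation integral_sup_until//.
pose H' (y : R * \bar R) := H (y.1%:E + y.2)%E.
have mH' : measurable_fun setT H'.
  by apply: measurableT_comp => //; apply: emeasurable_funD => //; exact: measurableT_comp.
have := @ge0_integral_incr_sup x 0 setT H' (lexx _) (filtrationT (lexx _)) mH' (fun=> H0 _).
rewrite [X in _ = X -> _](_ : _ = \int[prodP x]_z H (running_sup (X ^~ z.1) z.2))%E; last first.
  have mR : measurable_fun setT (fun z : T * \bar R => H (running_sup (X ^~ z.1) z.2)).
    by apply: (measurableT_comp mH); exact: measurable_levy_running_sup.
  rewrite (killed_tonelli x mR (fun=> H0 _)).
  apply: eq_integral => w _; apply: eq_integral => u _.
  by rewrite /H' /= -(sup_from_shift 0 (X ^~ w) u) add0e.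
move=> <-.
transitivity (\int[P x]_w (\int[prodP 0%R]_z H (x%:E + incr_sup 0 z.1 z.2)))%E; last first.
  by rewrite integral_cst// [X in (_ * X)%E](probability_setT (P x)) mule1.
have mfun (y : R) : measurable_fun setT (fun z : T * \bar R => H (y%:E + incr_sup 0 z.1 z.2)%E).
  apply: measurableT_comp => //; apply: emeasurable_funD => //.
  exact: measurable_incr_sup_prod.
apply: ge0_ae_eq_integral => //.
- have mf2 : measurable_fun setT (fun z : T * (T * \bar R) => H' (X 0 z.1, incr_sup 0 z.2.1 z.2.2)).
    apply: measurableT_comp => //; apply: measurable_fun_pair.
      by apply: measurableT_comp => //; exact: levy_measurable.
    by apply: measurable_incr_sup => //; exact: measurableT_comp.
  pose mu2 : probability (T * \bar R)%type R := (prodP 0)%E.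
  exact: (@measurable_fun_fubini_tonelli_F _ _ _ _ _ mu2 _ mf2 (fun=> H0 _)).
- by move=> w _; apply: integral_ge0 => ? _; exact: H0.
- by move=> w _; apply: integral_ge0 => ? _; exact: H0.
have := family_start hX x; apply: filterS => w Xw _.
by rewrite /H' /= Xw.
Qed.

(** The position at t plus the supremum of the later increments over a lifetime u is the supremum
    over [t, t + u]. The memoryless law replaces t + u by a killing time that is at least t and
    absorbs the discount. *)
Lemma killed_markov (H : \bar R -> \bar R) x t A : 0 <= t -> F t A ->
  measurable_fun setT H -> (forall y, 0 <= H y)%E ->
  ((expR (- r * t))%:E * \int[P x]_(w in A) killed_expectation H (X t w) =
   \int[P x]_(w in A) \int[kap]_(u in [set u | t%:E <= u]) H (sup_from t (X ^~ w) u))%E.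
Proof.
move=> t0 FA mH H0; have mA := levy_filtration_sub t0 FA.
pose H' (y : R * \bar R) := H (y.1%:E + y.2)%E.
have mH' : measurable_fun setT H'.
  by apply: measurableT_comp => //; apply: emeasurable_funD => //; exact: measurableT_comp.
rewrite (_ : \int[P x]_(w in A) _ =
    \int[P x]_(w in A) \int[kap]_u H' (X t w, incr_sup t w u))%E; last first.
  rewrite -ge0_integral_incr_sup//; last by move=> y; exact: H0.
  by apply: eq_integral => w _; rewrite killed_expectationE.
have mf1 : measurable_fun setT (fun z : T * \bar R => H' (X t z.1, incr_sup t z.1 z.2)).
  apply: measurableT_comp => //; apply: measurable_fun_pair.
    by apply: measurableT_comp => //; exact: levy_measurable.
  by apply: measurable_incr_sup => //; exact: measurableT_comp.
rewrite -ge0_integralZl//; last 2 first.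
- apply: measurable_funTS.
  exact: (measurable_killed_integral mf1 (fun=> H0 _)).
- by move=> w _; apply: integral_ge0 => ? _; exact: H0.
apply: eq_integral => w _.
rewrite -killing_memoryless//.
  congr (_ * _)%E; apply: eq_integral => u _.
  by rewrite sup_from_shift.
apply: measurableT_comp => //.
rewrite (_ : sup_from t _ = fun u => running_sup (fun s => X (t + s) w) (u - t%:E)%E); last first.
  by apply/funext => u; exact: sup_from_running.
apply: (@measurable_running_sup _ _ _ (fun s (u : \bar R) => X (t + s) w)) => //.
- exact: emeasurable_funB.
- by move=> _; exact: right_continuous_shift.
Qed.

(** The value of f at the dyadic time following tau. B is the whole line for the upper bound and
    [[xs - eta, +oo[] for the hitting time. The sample is 0 when tau is infinite, in accordance with
    the payoff at infinity. *)
Definition dyadic_sample m (tau : T -> \bar R) (B : set R) (f : R -> T -> \bar R) w :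
    \bar R :=
  if tau w is t%:E then
    if X (dyadic_ceil m t) w \in B then f (dyadic_ceil m t) w else 0%E
  else 0%E.

Definition dyadic_event m (tau : T -> \bar R) (B : set R) (k : nat) : set T :=
  [set w | ((k%:R * 2 ^- m)%:E <= tau w)%E /\ (tau w < (k.+1%:R * 2 ^- m)%:E)%E] `&`
  X (k.+1%:R * 2 ^- m) @^-1` B.

Lemma dyadic_time_ge0 m (k : nat) : 0 <= k%:R * 2 ^- m :> R.
Proof. by rewrite mulr_ge0// invr_ge0 exprn_ge0. Qed.

Lemma stopping_time_lt tau t : stopping_time F tau -> 0 <= t ->
  F t [set w | (tau w < t%:E)%E].
Proof.
move=> [tau0 Ftau] t0.
rewrite (_ : [set w | _] = \bigcup_(n : nat)
  (if 0 <= t - n.+1%:R^-1 then [set w | tau w <= (t - n.+1%:R^-1)%:E]%E else set0)).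
  rewrite -filtration_measurableE//; apply: bigcup_measurable => n _.
  case: ifPn => // tn; rewrite filtration_measurableE//.
  by apply: (levy_filtration_mono tn); [rewrite gerBl invr_ge0|exact: Ftau].
apply/seteqP; split => w /=.
  case tauw : (tau w) (tau0 w) => [s| |]//; rewrite lee_fin lte_fin => s0 st.
  have [n nts] : exists n : nat, n.+1%:R^-1 < t - s by apply: invS_lt; rewrite subr_gt0.
  exists n => //; rewrite ifT.
    by rewrite /= tauw lee_fin lerBrDl -lerBrDr ltW.
  by rewrite subr_ge0 (le_trans (ltW nts))// gerBl.
case=> n _; case: ifPn => // tn /= /le_lt_trans; apply.
by rewrite lte_fin ltrBlDr ltrDl invr_gt0.
Qed.

Lemma filtration_dyadic_event m tau B k : stopping_time F tau -> measurable B ->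
  F (k.+1%:R * 2 ^- m) (dyadic_event m tau B k).
Proof.
move=> stau mB; have k0 := dyadic_time_ge0 m k; have k10 := dyadic_time_ge0 m k.+1.
apply: filtrationI => //; last exact: (levy_adapted (family_levy hX 0)).
rewrite (_ : [set w | _] = [set w | tau w < (k.+1%:R * 2 ^- m)%:E]%E `\`
    [set w | tau w < (k%:R * 2 ^- m)%:E]%E).
  rewrite -filtration_measurableE//; apply: measurableD; rewrite filtration_measurableE//.
    exact: stopping_time_lt.
  apply: (levy_filtration_mono k0); last exact: stopping_time_lt.
  by rewrite ler_wpM2r ?invr_ge0 ?exprn_ge0// ler_nat.
apply/seteqP; split => w /=; first by case=> H1 H2; split => //; rewrite ltNge H1.
by case=> H1 /negP; rewrite -leNgt => H2.
Qed.

Lemma measurable_dyadic_event m tau B k : stopping_time F tau -> measurable B ->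
  measurable (dyadic_event m tau B k).
Proof.
move=> stau mB.
by apply: (levy_filtration_sub (dyadic_time_ge0 m k.+1)); exact: filtration_dyadic_event.
Qed.

Lemma dyadic_event_truncn m (tau : T -> \bar R) B k t w : 0 <= t -> tau w = t%:E ->
  dyadic_event m tau B k w <->
  k = Num.truncn (t * 2 ^+ m) /\ B (X (dyadic_ceil m t) w).
Proof.
move=> t0 tauw.
have tm : 0 <= t * 2 ^+ m by rewrite mulr_ge0// exprn_ge0.
have H : (k = Num.truncn (t * 2 ^+ m)) <->
    ((k%:R * 2 ^- m)%:E <= tau w)%E /\ (tau w < (k.+1%:R * 2 ^- m)%:E)%E.
  rewrite tauw lee_fin lte_fin ler_pdivrMr ?exprn_gt0// ltr_pdivlMr ?exprn_gt0//.
  split=> [->|[H1 H2]].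
    by split; [rewrite Num.Theory.truncn_le|exact: Num.Theory.truncnS_gt].
  by apply/esym/eqP; rewrite Num.Theory.truncn_eq// H1 H2.
split; first by case=> /H kE /= BX; split => //; rewrite /dyadic_ceil -kE.
by case=> kE BX; split; [apply/H|rewrite /= kE].
Qed.

Lemma dyadic_sampleE m tau B f k w : stopping_time F tau ->
  dyadic_event m tau B k w -> dyadic_sample m tau B f w = f (k.+1%:R * 2 ^- m) w.
Proof.
move=> [tau0 _] Dw; rewrite /dyadic_sample.
case tauw : (tau w) (tau0 w) => [t| |]//; last by case: Dw => -[]; rewrite tauw.
rewrite lee_fin => t0.
have [kE BX] := (dyadic_event_truncn _ _ _ t0 tauw).1 Dw.
by rewrite mem_set// /dyadic_ceil -kE.
Qed.

Lemma dyadic_sample0 m tau B f w : stopping_time F tau ->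
  ~ (\bigcup_k dyadic_event m tau B k) w -> dyadic_sample m tau B f w = 0%E.
Proof.
move=> [tau0 _] Dw; rewrite /dyadic_sample.
case tauw : (tau w) (tau0 w) => [t| |]//; rewrite lee_fin => t0.
rewrite memNset// => BX; apply: Dw; exists (Num.truncn (t * 2 ^+ m)) => //.
exact/(dyadic_event_truncn _ _ _ t0 tauw).
Qed.

Lemma trivIset_dyadic_event m (tau : T -> \bar R) B : trivIset setT (dyadic_event m tau B).
Proof.
have lt i j w : (i < j)%N -> dyadic_event m tau B i w -> ~ dyadic_event m tau B j w.
  move=> ij [[_ H1] _] [[H2 _] _]; have := le_lt_trans H2 H1.
  rewrite lte_fin ltr_pM2r ?invr_gt0 ?exprn_gt0// ltr_nat ltnS.
  by rewrite leqNgt ij.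
move=> i j _ _ [w [Di Dj]]; have [ij|ij|//] := ltngtP i j.
  by have := lt _ _ _ ij Di.
by have := lt _ _ _ ij Dj.
Qed.

Lemma measurable_dyadic_sample m tau B f : stopping_time F tau -> measurable B ->
  (forall c, 0 <= c -> measurable_fun setT (f c)) ->
  measurable_fun setT (dyadic_sample m tau B f).
Proof.
move=> stau mB mf; have mD k := measurable_dyadic_event m k stau mB.
have mU : measurable (\bigcup_k dyadic_event m tau B k) by exact: bigcup_measurable.
rewrite -(setUv (\bigcup_k dyadic_event m tau B k)).
apply/measurable_funU => //; first exact: measurableC.
split.
  apply/measurable_fun_bigcup => // k.
  apply: (@eq_measurable_fun _ _ _ _ _ (f (k.+1%:R * 2 ^- m))).
    by move=> w /set_mem Dw; rewrite (dyadic_sampleE _ stau Dw).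
  by apply: measurable_funTS; apply: mf; exact: dyadic_time_ge0.
apply: (@eq_measurable_fun _ _ _ _ _ (cst 0%E)); last exact: measurable_cst.
by move=> w /set_mem Dw; rewrite dyadic_sample0.
Qed.

Lemma integral_dyadic_sample x m tau B f : stopping_time F tau -> measurable B ->
  (forall c, 0 <= c -> measurable_fun setT (f c)) ->
  (forall c w, 0 <= c -> (0 <= f c w)%E) ->
  (\int[P x]_w dyadic_sample m tau B f w =
   \sum_(k <oo) \int[P x]_(w in dyadic_event m tau B k) f (k.+1%:R * 2 ^- m)%R w)%E.
Proof.
move=> stau mB mf f0; have mD k := measurable_dyadic_event m k stau mB.
have mU : measurable (\bigcup_k dyadic_event m tau B k) by exact: bigcup_measurable.
rewrite -(setUv (\bigcup_k dyadic_event m tau B k)).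
have ms := @measurable_dyadic_sample m tau B f stau mB mf.
have s0 w : (0 <= dyadic_sample m tau B f w)%E.
  have [[k _ Dw]|Dw] := pselect ((\bigcup_k dyadic_event m tau B k) w).
    by rewrite (dyadic_sampleE _ stau Dw) f0// dyadic_time_ge0.
  by rewrite dyadic_sample0.
rewrite ge0_integral_setU//; last 3 first.
- exact: measurableC.
- exact: measurable_funTS.
- by rewrite disj_set2E; apply/eqP; rewrite setICr.
rewrite [X in (_ + X)%E]integral0_eq ?adde0; last first.
  by move=> w Dw; rewrite dyadic_sample0.
rewrite ge0_integral_bigcup//; last 2 first.
- exact: measurable_funTS.
- exact: trivIset_dyadic_event.
apply: eq_eseriesr => k _; apply: eq_integral => w /set_mem Dw.
by rewrite (dyadic_sampleE _ stau Dw).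
Qed.

Lemma measurable_killed_expectation (H : \bar R -> \bar R) c : 0 <= c ->
  measurable_fun setT H -> (forall y, 0 <= H y)%E ->
  measurable_fun setT (fun w => killed_expectation H (X c w)).
Proof.
move=> c0 mH H0; rewrite [X in measurable_fun _ X](_ : _ =
    fun w => (\int[prodP 0%R]_z H ((X c w)%:E + incr_sup 0%R z.1 z.2))%E); last first.
  by apply/funext => w; rewrite killed_expectationE.
pose mu2 : probability (T * \bar R)%type R := (prodP 0)%E.
have mf : measurable_fun setT (fun z : T * (T * \bar R) =>
    H ((X c z.1)%:E + incr_sup 0%R z.2.1 z.2.2)%E).
  apply: (measurableT_comp mH); apply: emeasurable_funD.
    by apply/measurable_EFinP; apply: measurableT_comp => //; exact: levy_measurable.
  by apply: measurable_incr_sup => //; exact: measurableT_comp.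
exact: (@measurable_fun_fubini_tonelli_F _ _ _ _ _ mu2 _ mf (fun=> H0 _)).
Qed.

Definition killed_tail (H : \bar R -> \bar R) c w : \bar R :=
  (\int[kap]_(u in [set u | c%:E <= u]) H (sup_from c (X ^~ w) u))%E.

Lemma measurable_sup_from c : 0 <= c ->
  measurable_fun setT (fun z : T * \bar R => sup_from c (X ^~ z.1) z.2).
Proof.
move=> c0; under eq_fun do rewrite sup_from_running.
apply: (@measurable_running_sup _ _ _ (fun s (z : T * \bar R) => X (c + s) z.1)).
- move=> s s0; apply: (measurableT_comp (levy_measurable (addr_ge0 c0 s0)) measurable_fst).
- by apply: emeasurable_funB => //; exact: measurable_snd.
- by move=> z; exact: right_continuous_shift.
Qed.

Lemma measurable_killed_tail (H : \bar R -> \bar R) c : 0 <= c ->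
  measurable_fun setT H -> (forall y, 0 <= H y)%E ->
  measurable_fun setT (killed_tail H c).
Proof.
move=> c0 mH H0; rewrite /killed_tail; under eq_fun do rewrite integral_mkcond.
have mS := measurable_sup_from c0.
have mf : measurable_fun setT ((fun z : T * \bar R => H (sup_from c (X ^~ z.1) z.2)) \_
    (setT `*` [set u | (c%:E <= u)%E])).
  apply/measurable_restrict => //.
    by apply: measurableX => //; exact: measurable_ge_set.
  by apply: measurable_funTS; exact: measurableT_comp.
have := measurable_killed_integral mf (fun z => erestrict_ge0 (fun y _ => H0 _) z).
rewrite (_ : (fun w => \int[kap]_u _)%E = (fun w => \int[kap]_u
    ((fun u => H (sup_from c (X^~ w) u)) \_ [set u | c%:E <= u]) u))%E; last first.
  apply/funext => w; apply: eq_integral => u _; rewrite !patchE.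
  by rewrite in_setX in_setT.
by [].
Qed.

(** The sampled time has countably many values; on each [dyadic_event], which is known at the
    sampled time, it is constant and [killed_markov] applies. *)
Lemma dyadic_markov (H : \bar R -> \bar R) x m tau B :
  stopping_time F tau -> measurable B ->
  measurable_fun setT H -> (forall y, 0 <= H y)%E ->
  (\int[P x]_w dyadic_sample m tau B
     (fun c w => (expR (- r * c))%:E * killed_expectation H (X c w)) w =
   \int[P x]_w dyadic_sample m tau B
     (killed_tail H) w)%E.
Proof.
move=> stau mB mH H0.
have v0 y : (0 <= killed_expectation H y)%E by apply: integral_ge0 => *; exact: H0.
rewrite !integral_dyadic_sample//.
- apply: eq_eseriesr => k _.
  have FD := filtration_dyadic_event m k stau mB.
  have k0 := dyadic_time_ge0 m k.+1.
  rewrite -killed_markov// ge0_integralZl//.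
  + exact: measurable_dyadic_event.
  + by apply: measurable_funTS; exact: measurable_killed_expectation.
- by move=> c c0; exact: measurable_killed_tail.
- by move=> c w _; apply: integral_ge0 => *; exact: H0.
- by move=> c c0; apply: measurable_funeM; exact: measurable_killed_expectation.
- by move=> c w _; rewrite mule_ge0.
Qed.

Lemma integral_killed x (H : \bar R -> \bar R) :
  measurable_fun setT H -> (forall u, 0 <= H u)%E ->
  (\int[P x]_w \int[kap]_u H (running_sup (X ^~ w) u) = killed_expectation H x)%E.
Proof.
move=> mH H0; rewrite /killed_expectation integral_sup_until// killed_tonelli//.
by apply: (measurableT_comp mH); exact: measurable_levy_running_sup.
Qed.

Lemma measurable_killed_integral_sup (H : \bar R -> \bar R) :
  measurable_fun setT H -> (forall u, 0 <= H u)%E ->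
  measurable_fun setT (fun w => \int[kap]_u H (running_sup (X ^~ w) u))%E.
Proof.
move=> mH H0.
have mR : measurable_fun setT (fun z : T * \bar R => H (running_sup (X ^~ z.1) z.2)).
  by apply: (measurableT_comp mH); exact: measurable_levy_running_sup.
exact: (measurable_killed_integral mR (fun=> H0 _)).
Qed.

Lemma measurable_running_sup_path w : measurable_fun setT (running_sup (X ^~ w)).
Proof.
apply: (@measurable_running_sup _ _ _ (fun s (u : \bar R) => X s w)) => // _.
exact: levy_right_continuous.
Qed.

(** * Payoffs at stopping times *)

Section stopped_payoff.
Context (g h : R -> R).
Hypotheses (g0 : forall y, 0 <= g y) (gcont : continuous g).
Hypotheses (gneg : forall y, y <= 0 -> g y = 0) (gh : forall y, g y <= h y).
Hypotheses (hmono : {homo h : y z / y <= z}) (hneg : forall y, y <= 0 -> h y = h 0).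
Hypothesis hfin : forall x, (killed_expectation (ereal_ext h) x < +oo)%E.
Hypothesis zero_rate : r = 0 -> forall x,
  {ae P x, forall w, exists N : nat, forall s, N%:R <= s -> X s w <= 0}.

Let h0 y : 0 <= h y. Proof. exact: le_trans (gh y). Qed.

Let mh : measurable_fun setT (ereal_ext h).
Proof. by apply: measurable_ereal_ext; exact: nondecreasing_measurable. Qed.

Let eh0 z : (0 <= ereal_ext h z)%E. Proof. exact: ereal_ext_ge0. Qed.

Definition payoff_bound w : \bar R :=
  (\int[kap]_u ereal_ext h (running_sup (X ^~ w) u))%E.

Lemma integrable_payoff_bound x : (P x).-integrable setT payoff_bound.
Proof.
apply/integrableP; split; first exact: measurable_killed_integral_sup.
under eq_integral do rewrite gee0_abs ?integral_ge0//.
by rewrite integral_killed.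
Qed.

(** The discount is the mass that the killing law gives to times u >= t, and for these u the
    position at t is at most the running supremum. *)
Lemma payoff_le_tail t w : 0 <= t ->
  ((expR (- r * t) * g (X t w))%:E <=
   \int[kap]_(u in [set u | t%:E <= u]) ereal_ext h (running_sup (X ^~ w) u))%E.
Proof.
move=> t0; apply: (@le_trans _ _ (\int[kap]_(u in [set u | t%:E <= u]) (g (X t w))%:E)%E).
  rewrite integral_cst; last exact: measurable_ge_set.
  by rewrite [X in (_ <= _ * X)%E](killing_law_ge he r0 t0) -EFinM mulrC.
apply: ge0_le_integral => //.
- exact: measurable_ge_set.
- by move=> u _; rewrite lee_fin.
- apply: measurable_funTS; apply: (measurableT_comp mh).
  exact: measurable_running_sup_path.
move=> u /= tu; apply: (@le_trans _ _ (ereal_ext h (X t w)%:E)).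
  by rewrite /= lee_fin.
by apply: le_ereal_ext => //; exact: running_sup_ge.
Qed.

Lemma payoff_le_bound t w : 0 <= t ->
  ((expR (- r * t) * g (X t w))%:E <= payoff_bound w)%E.
Proof.
move=> t0; apply: (le_trans (payoff_le_tail w t0)).
apply: ge0_subset_integral => //; first exact: measurable_ge_set.
by apply: (measurableT_comp mh); exact: measurable_running_sup_path.
Qed.

(** [payoff_le_tail] bounds the payoff by the tail of a finite integral. The tail vanishes because
    for r > 0 the killing law has no mass at [+oo]. *)
Lemma payoff_cvg0 w : 0 < r -> (payoff_bound w < +oo)%E ->
  forall eps, 0 < eps ->
  exists N : nat, forall t, N%:R <= t -> expR (- r * t) * g (X t w) <= eps.
Proof.
move=> rpos Zfin eps eps0.
have mf : measurable_fun setT (fun u => ereal_ext h (running_sup (X ^~ w) u)).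
  by apply: (measurableT_comp mh); exact: measurable_running_sup_path.
pose B (n : nat) : set (\bar R) := [set u | u < n%:R%:E]%E.
have BC n : B n = ~` [set u | n%:R%:E <= u]%E.
  by apply/seteqP; split => u; rewrite /B /= ltNge => /negP.
have mB n : measurable (B n) by rewrite BC; apply: measurableC; exact: measurable_ge_set.
have cvgB : (\int[kap]_(u in B n) ereal_ext h (running_sup (X ^~ w) u))%E @[n --> \oo]
    --> payoff_bound w.
  rewrite (_ : payoff_bound w = \int[kap]_(u in \bigcup_n B n)
      ereal_ext h (running_sup (X ^~ w) u))%E.
    apply: ge0_nondecreasing_set_cvg_integral => //.
      move=> m n mn; apply/subsetPset => u /= /lt_le_trans; apply.
      by rewrite lee_fin ler_nat.
    by move=> n; exact: measurable_funTS.
  rewrite (_ : \bigcup_n B n = setT `\` [set +oo%E]).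
    apply: ge0_negligible_integral => //.
    exact: killing_law_infinite.
  apply/seteqP; split => u /=.
    by case=> n _; rewrite /B /= => un; split => // uE; rewrite uE in un.
  case=> _; case: u => [u _| |_].
  - by exists (Num.truncn u).+1 => //=; rewrite /B /= lte_fin Num.Theory.truncnS_gt.
  - by move=> /(_ erefl).
  - by exists 0%N => //=; rewrite /B /= ltNyr.
have Z0 : (0 <= payoff_bound w)%E by exact: integral_ge0.
have Zf : payoff_bound w \is a fin_num by rewrite ge0_fin_numE.
have := cvgB; rewrite -(fineK Zf) => /fine_cvgP[near_fin].
move=> /cvgrPdist_lt/(_ _ eps0)[N1 _ N1P].
case: near_fin => N2 _ N2P.
exists (maxn N1 N2) => t Nt.
have t0 : 0 <= t by exact: le_trans Nt.
rewrite -lee_fin; apply: (le_trans (payoff_le_tail w t0)).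
set N := maxn N1 N2 in Nt *.
apply: (@le_trans _ _ (\int[kap]_(u in [set u | N%:R%:E <= u])
    ereal_ext h (running_sup (X ^~ w) u))%E).
  apply: ge0_subset_integral => //; [exact: measurable_ge_set|exact: measurable_ge_set| |].
    exact: measurable_funTS.
  by move=> u /=; apply: le_trans; rewrite lee_fin.
have split_Z : payoff_bound w = (\int[kap]_(u in B N) ereal_ext h (running_sup (X ^~ w) u) +
    \int[kap]_(u in [set u | N%:R%:E <= u]) ereal_ext h (running_sup (X ^~ w) u))%E.
  rewrite /payoff_bound -ge0_integral_setU//.
  - by rewrite BC setvU.
  - exact: measurable_ge_set.
  - exact: measurable_funTS.
  - by rewrite BC disj_set2E; apply/eqP; rewrite setICl.
have IBf := N2P N (leq_maxr _ _).
have := N1P N (leq_maxl _ _); rewrite /comp /= => H1.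
have : (\int[kap]_(u in [set u | N%:R%:E <= u]) ereal_ext h (running_sup (X ^~ w) u) =
    payoff_bound w - \int[kap]_(u in B N) ereal_ext h (running_sup (X ^~ w) u))%E.
  by rewrite split_Z addeC addeK.
move=> ->; rewrite -(fineK Zf) -(fineK IBf) -EFinB lee_fin.
by apply: ltW; exact: le_lt_trans (ler_norm _) H1.
Qed.

Definition stopped_payoff (tau : T -> \bar R) w : \bar R :=
  if tau w is t%:E then (expR (- r * t) * g (X t w))%:E else 0%E.

Lemma limf_esup_payoff_eq0 w : (payoff_bound w < +oo)%E ->
  (r = 0 -> exists N : nat, forall s, N%:R <= s -> X s w <= 0) ->
  limf_esup (fun t => (expR (- r * t) * g (X t w))%:E) +oo%R = 0%E.
Proof.
move=> Zfin ev0.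
have payge0 t : (0 <= (expR (- r * t) * g (X t w))%:E)%E.
  by rewrite lee_fin mulr_ge0// expR_ge0.
apply/eqP; rewrite eq_le; apply/andP; split; last first.
  apply: limf_esup_ge0 => //; exact: filter_not_empty.
apply/lee_addgt0Pr => eps eps0; rewrite add0e.
have [N NP] : exists N : nat, forall t, N%:R <= t -> expR (- r * t) * g (X t w) <= eps.
  have [rpos|rneg|rE] := ltgtP 0 r; first exact: payoff_cvg0.
    by move: r0; rewrite leNgt rneg.
  have [N NP] := ev0 (esym rE); exists N => t Nt.
  by rewrite (gneg (NP _ Nt)) mulr0 ltW.
apply: (@le_trans _ _ (ereal_sup ((fun t => (expR (- r * t) * g (X t w))%:E) @`
    [set t : R | N%:R < t]))).
  apply: ereal_inf_lbound; exists [set t : R | N%:R < t] => //.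
  by exists N%:R; split.
apply: ge_ereal_sup => _ [t /= Nt <-]; rewrite lee_fin; apply: NP; exact: ltW.
Qed.

Lemma payoff_bound_fin x : {ae P x, forall w, (payoff_bound w < +oo)%E}.
Proof.
have := integrable_ae measurableT (integrable_payoff_bound x).
by apply: filterS => w /(_ Logic.I); rewrite fin_numElt => /andP[].
Qed.

Lemma discounted_payoff_ae x :
  {ae P x, forall w, forall tau, discounted_payoff r g X tau w = stopped_payoff tau w}.
Proof.
have lim0 : {ae P x, forall w,
    limf_esup (fun t => (expR (- r * t) * g (X t w))%:E) +oo%R = 0%E}.
  have [rE|rN] := pselect (r = 0).
    apply: filterS2 (payoff_bound_fin x) (zero_rate rE x) => w Zw ev.
    exact: limf_esup_payoff_eq0.
  by apply: filterS (payoff_bound_fin x) => w Zw; apply: limf_esup_payoff_eq0.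
apply: filterS lim0 => w lim0 tau.
by rewrite /discounted_payoff /stopped_payoff lim0; case: (tau w).
Qed.

(* F 0 contains the sets that are null for every P x. *)
Lemma payoff_measurable_eq (f1 f2 : T -> \bar R) :
  (forall x, {ae P x, forall w, f1 w = f2 w}) -> measurable_fun setT f2 ->
  measurable_fun setT f1.
Proof.
move=> f12 mf2 _ B mB; rewrite setTI.
have null N : (forall x, (P x).-negligible N) -> measurable N.
  move=> nN; apply: (levy_filtration_sub (lexx 0)).
  exact: (filtration_complete (family_usual hX)).
pose N := [set w | f1 w <> f2 w].
have mN : measurable N by apply: null => x; exact: f12.
rewrite (_ : f1 @^-1` B = (f2 @^-1` B `\` N) `|` (f1 @^-1` B `&` N)).
  apply: measurableU.
    by apply: measurableD => //; rewrite -[X in measurable X]setTI; exact: mf2.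
  apply: null => x; apply: (negligibleS _ (f12 x)).
  by move=> w [_ Nw].
apply/seteqP; split => w /=.
  move=> Bw; have [E|E] := pselect (f1 w = f2 w); last by right.
  by left; rewrite -E; split => // NE; exact: NE.
case=> [[Bw Nw]|[]//]; rewrite (_ : f1 w = f2 w)//.
by apply: contrapT.
Qed.

Lemma measurable_payoff c : 0 <= c ->
  measurable_fun setT (fun w => (expR (- r * c) * g (X c w))%:E).
Proof.
move=> c0; apply/measurable_EFinP; apply: measurable_funM => //.
apply: (measurableT_comp (continuous_measurable_fun gcont)).
exact: levy_measurable.
Qed.

Definition payoff_sample m tau w : \bar R :=
  dyadic_sample m tau setT (fun c w => (expR (- r * c) * g (X c w))%:E) w.

Lemma payoff_sample_cvg tau w : stopping_time F tau ->
  payoff_sample m tau w @[m --> \oo] --> stopped_payoff tau w.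
Proof.
move=> [tau0 _]; rewrite /payoff_sample /dyadic_sample /stopped_payoff.
case tauw : (tau w) (tau0 w) => [t| |]//; last by move=> _; exact: cvg_cst.
rewrite lee_fin => t0.
under eq_cvg do rewrite in_setT.
apply: cvg_EFin; first exact: nearW.
rewrite /comp /=.
have cc : dyadic_ceil m t @[m --> \oo] --> t.
  apply/cvgrPdist_lt => eps eps0; have [N NP] := dyadic_small eps0.
  exists N => // m /= /NP mE.
  have := dyadic_ceil_gt m t0; have := dyadic_ceil_le m t0.
  by move=> ? ?; rewrite distrC ger0_norm; lra.
have cX : X (dyadic_ceil m t) w @[m --> \oo] --> X t w.
  apply/cvgrPdist_lt => eps eps0.
  have [D D0 DP] := right_continuous_dist (@levy_right_continuous w) t0 eps0.
  have [N NP] := dyadic_small D0; exists N => // m /= /NP mD.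
  have := dyadic_ceil_gt m t0; have := dyadic_ceil_le m t0.
  by move=> ? ?; apply: DP; lra.
have cg : g (X (dyadic_ceil m t) w) @[m --> \oo] --> g (X t w).
  by apply: continuous_cvg cX; exact: gcont.
have ce : expR (- r * dyadic_ceil m t) @[m --> \oo] --> expR (- r * t).
  apply: continuous_cvg; first exact: continuous_expR.
  by apply: cvgM cc; exact: cvg_cst.
exact: cvgM ce cg.
Qed.

Lemma measurable_payoff_sample m tau : stopping_time F tau ->
  measurable_fun setT (payoff_sample m tau).
Proof. by move=> stau; apply: measurable_dyadic_sample => //; exact: measurable_payoff. Qed.

Lemma measurable_stopped_payoff tau : stopping_time F tau ->
  measurable_fun setT (stopped_payoff tau).
Proof.
move=> stau; apply: (emeasurable_fun_cvg (fun m => payoff_sample m tau)).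
  by move=> m; exact: measurable_payoff_sample.
by move=> w _; exact: payoff_sample_cvg.
Qed.

Lemma integral_discounted_payoff x tau : stopping_time F tau ->
  (\int[P x]_w discounted_payoff r g X tau w = \int[P x]_w stopped_payoff tau w)%E.
Proof.
move=> stau.
have mS := measurable_stopped_payoff stau.
have E y : {ae P y, forall w, discounted_payoff r g X tau w = stopped_payoff tau w}.
  by apply: filterS (discounted_payoff_ae y) => w; apply.
apply: ae_eq_integral => //; first exact: payoff_measurable_eq mS.
by apply: filterS (E x) => w Ew _.
Qed.

Lemma payoff_sample_ge0 m tau w : (0 <= payoff_sample m tau w)%E.
Proof.
rewrite /payoff_sample /dyadic_sample; case: (tau w) => // t; case: ifP => // _.
by rewrite lee_fin mulr_ge0// expR_ge0.
Qed.

Lemma integral_payoff_sample_cvg x tau : stopping_time F tau ->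
  (\int[P x]_w payoff_sample m tau w)%E @[m --> \oo] -->
  (\int[P x]_w stopped_payoff tau w)%E.
Proof.
move=> stau.
have [] := @dominated_convergence _ _ _ (P x) setT measurableT
  (fun m => payoff_sample m tau) (stopped_payoff tau) payoff_bound.
- by move=> m; exact: measurable_payoff_sample.
- exact: measurable_stopped_payoff.
- by apply: aeW => w _; exact: payoff_sample_cvg.
- exact: integrable_payoff_bound.
- apply: aeW => w m _; rewrite gee0_abs ?payoff_sample_ge0//.
  rewrite /payoff_sample /dyadic_sample; case: (tau w) => [t| |]; try exact: integral_ge0.
  by case: ifP => _; [apply: payoff_le_bound; exact: dyadic_ceil_ge0|exact: integral_ge0].
by [].
Qed.

Lemma measurable_sup_from_path c w : 0 <= c ->
  measurable_fun setT (sup_from c (X ^~ w)).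
Proof.
move=> c0; have -> : sup_from c (X ^~ w) =
    fun u => running_sup (fun s => X (c + s) w) (u - c%:E)%E.
  by apply/funext => u; exact: sup_from_running.
apply: (@measurable_running_sup _ _ _ (fun s (u : \bar R) => X (c + s) w)) => //.
- by apply: emeasurable_funB => //; exact: measurable_cst.
- by move=> _; exact: right_continuous_shift.
Qed.

Lemma killed_tail_le (H : \bar R -> \bar R) c w : 0 <= c ->
  measurable_fun setT H -> (forall y, 0 <= H y)%E ->
  {homo H : y z / (y <= z)%E} ->
  (killed_tail H c w <= \int[kap]_u H (running_sup (X ^~ w) u))%E.
Proof.
move=> c0 mH H0 Hmono; rewrite /killed_tail.
have mc : measurable_fun setT (fun u => H (sup_from c (X ^~ w) u)).
  by apply: (measurableT_comp mH); exact: measurable_sup_from_path.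
apply: (@le_trans _ _ (\int[kap]_u H (sup_from c (X ^~ w) u))%E).
  by apply: ge0_subset_integral => //; exact: measurable_ge_set.
apply: ge0_le_integral => //.
  by apply: (measurableT_comp mH); exact: measurable_running_sup_path.
by move=> u _; apply: Hmono; exact: sup_from_le.
Qed.

(** * The value function and the payoff *)

Section verification.
Context (G : R -> R) (xs : R).
Hypotheses (xs0 : 0 < xs) (Gmono : {homo G : y z / y <= z}).
Hypotheses (Gxs : forall y, y <= xs -> G y = 0) (Gcont : continuous G).

Let G0 y : 0 <= G y.
Proof.
have [yx|xy] := leP y xs; first by rewrite Gxs.
by rewrite -(Gxs (lexx xs)); apply: Gmono; exact: ltW.
Qed.

Let mG : measurable_fun setT G. Proof. exact: continuous_measurable_fun. Qed.

Let meG : measurable_fun setT (ereal_ext G). Proof. exact: measurable_ereal_ext. Qed.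

Let eG0 z : (0 <= ereal_ext G z)%E. Proof. exact: ereal_ext_ge0. Qed.

Let eGmono : {homo ereal_ext G : y z / (y <= z)%E}.
Proof.
apply: le_ereal_ext => // y y0; rewrite !Gxs//; first exact: ltW.
by apply: le_trans y0 _; exact: ltW.
Qed.

Lemma stopped_payoff_le x tau : stopping_time F tau ->
  (forall y, (g y)%:E <= killed_expectation (ereal_ext G) y)%E ->
  (\int[P x]_w stopped_payoff tau w <= killed_expectation (ereal_ext G) x)%E.
Proof.
move=> stau gV.
have cvgI := integral_payoff_sample_cvg (x := x) stau.
rewrite -(cvg_lim (@ereal_hausdorff R) cvgI).
apply: lime_le; first by apply/cvg_ex; exists (\int[P x]_w stopped_payoff tau w)%E.
apply: nearW => m.
have mV c : 0 <= c -> measurable_fun setT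
    (fun w => (expR (- r * c))%:E * killed_expectation (ereal_ext G) (X c w))%E.
  by move=> c0; apply: emeasurable_funM => //; exact: measurable_killed_expectation.
apply: (@le_trans _ _ (\int[P x]_w dyadic_sample m tau setT
    (fun c w => (expR (- r * c))%:E * killed_expectation (ereal_ext G) (X c w)) w)%E).
  apply: ge0_le_integral => //.
  - by move=> w _; exact: payoff_sample_ge0.
  - exact: measurable_payoff_sample.
  - by apply: measurable_dyadic_sample.
  move=> w _; rewrite /payoff_sample /dyadic_sample; case: (tau w) => // t.
  by rewrite in_setT EFinM; apply: lee_wpmul2l.
rewrite dyadic_markov// -integral_killed//.
apply: ge0_le_integral => //.
- move=> w _; rewrite /dyadic_sample; case: (tau w) => // t; case: ifP => // _.
  exact: integral_ge0.
- by apply: measurable_dyadic_sample => // c c0; exact: measurable_killed_tail.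
- exact: measurable_killed_integral_sup.
move=> w _; rewrite /dyadic_sample; case: (tau w) => [t| |]; try exact: integral_ge0.
case: ifP => _; last exact: integral_ge0.
by apply: killed_tail_le => //; exact: dyadic_ceil_ge0.
Qed.

Lemma hitting_time_attained w t : 0 <= t -> hitting_time X xs w = t%:E -> xs <= X t w.
Proof.
move=> t0 ht; have := lexx (hitting_time X xs w).
rewrite {2}ht hitting_time_leP// => -[s [s0 st Xs]].
suff /eqP <- : s == t by [].
rewrite eq_le st/= -lee_fin -ht; apply: ereal_inf_lbound; by exists s.
Qed.

(** The dyadic times lie strictly after the hitting time t and would miss a supremum attained only
    at t. Right-continuity prolongs an exceedance at t, and u different from t leaves room for
    it. *)
Lemma running_sup_gt_after w t u z : 0 <= t -> hitting_time X xs w = t%:E ->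
  u != t%:E -> xs <= z -> (z%:E < running_sup (X ^~ w) u)%E ->
  exists2 s, t < s & (s%:E <= u)%E /\ z < X s w.
Proof.
move=> t0 ht ut xz /running_sup_gtP[s [s0 su zX]].
have ts : t <= s.
  rewrite -lee_fin -ht; apply: ereal_inf_lbound; exists s => //; split => //.
  by apply: (le_trans xz); exact: ltW.
have [ts'|//|tsE] := ltgtP t s; first by exists s.
  by move=> st; move: ts; rewrite leNgt st.
have [D D0 DP] := right_continuous_gt (@levy_right_continuous w) s0 zX.
have {}ut : (s%:E < u)%E by rewrite lt_neqAle su -tsE eq_sym ut.
have D2 : s < s + D / 2 < s + D by apply/andP; split; lra.
case/andP: D2 => D2 D2'.
case: u su ut => [u| |] //; rewrite ?lte_fin => _ ut.
  exists (Num.min (s + D / 2) u); first by rewrite tsE lt_min D2.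
  split; first by rewrite lee_fin ge_min lexx orbT.
  apply: DP; first by rewrite le_min (ltW D2) ltW.
  by rewrite gt_min D2'.
exists (s + D / 2); first by rewrite tsE.
by split; [exact: leey|apply: DP => //; exact: ltW].
Qed.

(** If G of the supremum up to u is positive, the supremum exceeds xs, and any level between xs and
    it is exceeded at some s after the hitting time. The dyadic times eventually precede s, so the
    suprema restarted at them see that level too; continuity of G concludes. *)
Lemma killed_tail_liminf eta w : 0 < eta ->
  (\int[kap]_u (G (fine (running_sup (X ^~ w) u)))%:E <=
   limn_einf (fun m => dyadic_sample m (hitting_time X xs) `[(xs - eta)%R, +oo[%classic
     (killed_tail (ereal_ext G)) w))%E.
Proof.
move=> eta0; pose B : set R := `[(xs - eta)%R, +oo[%classic; rewrite -/B.
have D0 m : (0 <= dyadic_sample m (hitting_time X xs) B (killed_tail (ereal_ext G)) w)%E.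
  by rewrite /dyadic_sample; case: hitting_time => // t; case: ifP => // _; exact: integral_ge0.
have /(_ w) taus0 := (hitting_time_stopping xs).1.
case ht : (hitting_time X xs w) taus0 => [t| |]//; last first.
  move=> _; rewrite integral0_eq; first by apply: limn_einf_ge; exact: nearW.
  move=> u _; rewrite Gxs//.
  have : (running_sup (X ^~ w) u <= xs%:E)%E.
    apply: ge_ereal_sup => _ [s [s0 su] <-]; rewrite lee_fin leNgt; apply/negP => xX.
    suff : (hitting_time X xs w <= s%:E)%E by rewrite ht leye_eq.
    by apply: ereal_inf_lbound; exists s => //; split => //; exact: ltW.
  by case: running_sup => [y| |] //= _; exact: ltW.
rewrite lee_fin => t0.
pose c m := dyadic_ceil m t.
pose f m (u : \bar R) : \bar R := if X (c m) w \in B then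
   ((fun u => ereal_ext G (sup_from (c m) (X ^~ w) u)) \_ [set u | (c m)%:E <= u]%E) u else 0%E.
have DE m : dyadic_sample m (hitting_time X xs) B (killed_tail (ereal_ext G)) w =
    (\int[kap]_u f m u)%E.
  rewrite /dyadic_sample ht /f /killed_tail -/(c m); case: ifP => _.
    by rewrite integral_mkcond.
  by rewrite integral0.
under [X in (_ <= limn_einf X)%E]eq_fun do rewrite DE.
have mf m : measurable_fun setT (f m).
  rewrite /f; case: (X (c m) w \in B); last exact: measurable_cst.
  apply/measurable_restrict => //; first exact: measurable_ge_set.
  apply: measurable_funTS; apply: (measurableT_comp meG).
  by apply: measurable_sup_from_path; exact: dyadic_ceil_ge0.
have f0 m u : (0 <= f m u)%E.
  by rewrite /f; case: ifP => // _; rewrite patchE; case: ifP.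
apply: (le_trans _ (fatou kap measurableT mf (fun m u _ => f0 m u))).
apply: ae_ge0_le_integral => //.
- by move=> u _; rewrite lee_fin.
- apply/measurable_EFinP; apply: (measurableT_comp mG).
  by apply: measurableT_comp => //; exact: measurable_running_sup_path.
- by move=> u _; apply: limn_einf_ge; exact: nearW.
- exact: measurable_fun_limn_einf.
(* Killing exactly at the hitting time is excluded: the supremum may then exceed xs although every
   later sample is 0. *)
exists [set t%:E]; split => //; first exact: killing_law_atomless.
move=> u /=; apply: contra_notP => /eqP ut _.
have Xt := hitting_time_attained t0 ht.
have [GS|GS] := leP (G (fine (running_sup (X ^~ w) u))) 0.
  apply: (@le_trans _ _ 0%E); first by rewrite lee_fin.
  by apply: limn_einf_ge; exact: nearW.
have {GS} : xs < fine (running_sup (X ^~ w) u).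
  by rewrite ltNge; apply/negP => /Gxs GE; rewrite GE ltxx in GS.
(* [fine] sends an infinite supremum to 0, which is below xs. *)
case SE : (running_sup (X ^~ w) u) => [v| |] /=; last 2 first.
  by move=> /(lt_trans xs0); rewrite ltxx.
  by move=> /(lt_trans xs0); rewrite ltxx.
move=> xv; apply/lee_addgt0Pr => eps eps0; rewrite -leeBlDr// -EFinB.
have /cvgrPdist_lt/(_ eps eps0) : G y @[y --> v] --> G v by exact: Gcont.
move=> /nbhs_ballP[rho /= rho0 rhoP].
pose z := Num.max xs (v - rho / 2).
have zv : z < v by rewrite gt_max xv/=; lra.
have Gz : G v - eps < G z.
  have /rhoP : ball v rho z.
    rewrite /ball/= gtr0_norm ?subr_gt0//.
    have : v - rho / 2 <= z by rewrite le_max lexx orbT.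
    by lra.
  by move=> /= H; have := le_lt_trans (ler_norm _) H; lra.
have xz : xs <= z by rewrite le_max lexx.
have zS : (z%:E < running_sup (X ^~ w) u)%E by rewrite SE lte_fin.
have [s ts [su zX]] := running_sup_gt_after t0 ht ut xz zS.
(* The margin eta makes the inequality at t strict, so right-continuity keeps the samples in [B]
   from some m on. *)
have etaX : xs - eta < X t w by lra.
have [D' D'0 D'P] := right_continuous_gt (@levy_right_continuous w) t0 etaX.
apply: limn_einf_ge.
have mindist : 0 < Num.min (s - t) D' by rewrite lt_min D'0 subr_gt0 ts.
have [N NP] := dyadic_small mindist.
exists N => // m /= /NP; rewrite lt_min => /andP[ms mD].
have cgt := dyadic_ceil_gt m t0; have cle := dyadic_ceil_le m t0.
have cs : c m <= s by rewrite /c; lra.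
rewrite /f mem_set; last first.
  rewrite /B /= in_itv/= andbT; apply: ltW; apply: D'P; rewrite -?/(c m); first exact: ltW.
  by rewrite /c; lra.
rewrite patchE mem_set/=; last by apply: le_trans su; rewrite lee_fin.
apply: (@le_trans _ _ (ereal_ext G (X s w)%:E)).
  by rewrite lee_fin; apply: (le_trans (ltW Gz)); apply: Gmono; exact: ltW.
by apply: eGmono; apply: ereal_sup_ubound; exists s.
Qed.

(** Fatou's lemma is applied over the killing law in [killed_tail_liminf] and over [P x] here. The
    samples in [B] then satisfy V <= g + eps, and the discount only decreases the error eps. *)
Lemma stopped_payoff_hitting_ge x :
  (forall eps, 0 < eps -> exists2 eta, 0 < eta & forall y, xs - eta <= y ->
    (killed_expectation (ereal_ext G) y <= (g y + eps)%:E)%E) ->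
  (killed_expectation (fun z => (G (fine z))%:E) x <=
   \int[P x]_w stopped_payoff (hitting_time X xs) w)%E.
Proof.
move=> Vg; have stau := hitting_time_stopping xs.
set tau := hitting_time X xs in stau *.
apply/lee_addgt0Pr => eps eps0; have [eta eta0 etaP] := Vg eps eps0.
pose B := `[(xs - eta)%R, +oo[%classic : set R.
have mB : measurable B by exact: measurable_itv.
pose D m w := dyadic_sample m tau B (killed_tail (ereal_ext G)) w.
have mD m : measurable_fun setT (D m).
  by apply: measurable_dyadic_sample => // c c0; exact: measurable_killed_tail.
have D0 m w : (0 <= D m w)%E.
  rewrite /D /dyadic_sample; case: (tau w) => // t; case: ifP => // _; exact: integral_ge0.
have mH : measurable_fun setT (fun z : \bar R => (G (fine z))%:E).
  by apply/measurable_EFinP; exact: (measurableT_comp mG).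
have H0 (z : \bar R) : (0 <= (G (fine z))%:E)%E by rewrite lee_fin.
rewrite -integral_killed//.
apply: (@le_trans _ _ (\int[P x]_w limn_einf (D^~ w))%E).
  apply: ge0_le_integral => //.
  - by move=> w _; exact: integral_ge0.
  - exact: measurable_killed_integral_sup mH H0.
  - exact: measurable_fun_limn_einf.
  - by move=> w _; exact: killed_tail_liminf.
apply: (le_trans (fatou (P x) measurableT mD (fun m w _ => D0 m w))).
have cvgI := integral_payoff_sample_cvg (x := x) stau.
have cvgIe : (\int[P x]_w payoff_sample m tau w + eps%:E)%E @[m --> \oo] -->
    (\int[P x]_w stopped_payoff tau w + eps%:E)%E.
  by apply: cvgeD => //; [exact: fin_num_adde_defl|exact: cvg_cst].
rewrite -(cvg_limn_einf_sup cvgIe).1; apply: le_limn_einf => m.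
rewrite -dyadic_markov//.
apply: (@le_trans _ _ (\int[P x]_w (payoff_sample m tau w + eps%:E))%E); last first.
  rewrite ge0_integralD//.
  - rewrite leeD2l// integral_cst// [X in (_ * X)%E](probability_setT (P x)).
    by rewrite mule1.
  - by move=> w _; exact: payoff_sample_ge0.
  - exact: measurable_payoff_sample.
  - by move=> w _; rewrite lee_fin ltW.
have mV c : 0 <= c -> measurable_fun setT
    (fun w => (expR (- r * c))%:E * killed_expectation (ereal_ext G) (X c w))%E.
  by move=> c0; apply: emeasurable_funM => //; exact: measurable_killed_expectation.
apply: ge0_le_integral => //.
- move=> w _; rewrite /dyadic_sample; case: (tau w) => // t; case: ifP => // _.
  by rewrite mule_ge0// ?lee_fin ?expR_ge0//; exact: integral_ge0.
- exact: measurable_dyadic_sample.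
- by apply: emeasurable_funD => //; exact: measurable_payoff_sample.
have e0 : (0 <= eps%:E)%E by rewrite lee_fin ltW.
move=> w _; rewrite /payoff_sample /dyadic_sample; case htw : (tau w) => [t| |];
  rewrite ?add0e//.
have t0 : 0 <= t by rewrite -lee_fin -htw; exact: stau.1.
rewrite in_setT; case: ifP => [/set_mem|_]; last first.
  by rewrite adde_ge0// lee_fin mulr_ge0// expR_ge0.
rewrite /B /= in_itv/= andbT => /etaP VX.
set c := dyadic_ceil m t in VX *.
apply: (@le_trans _ _ ((expR (- r * c))%:E * (g (X c w) + eps)%:E)%E).
  by apply: lee_wpmul2l => //; rewrite lee_fin expR_ge0.
rewrite -EFinM -EFinD lee_fin mulrDr lerD2l ger_pMl// -[leRHS]expR0 ler_expR.
by rewrite mulNr oppr_le0 mulr_ge0// dyadic_ceil_ge0.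
Qed.

End verification.
End stopped_payoff.

(** * Moments of the supremum up to the killing time *)

Lemma killing_time_ge0 x : {ae P x, forall w, (0 <= e w)%E}.
Proof.
have mE : measurable (e @^-1` [set u | (0%:E <= u)%E]).
  rewrite -[X in measurable X]setTI; apply: (killing_measurable he) => //.
  exact: measurable_ge_set.
exists (~` (e @^-1` [set u | (0%:E <= u)%E])); split => //.
  exact: measurableC.
rewrite [LHS](probability_setC (P x) mE) (killing_lawE he r0)//; last exact: measurable_ge_set.
by rewrite [X in (1 - X)%E](killing_law_ge he r0 (lexx 0)) mulr0 expR0 subee.
Qed.

Lemma sup_until_ge_start x : {ae P x, forall w, (x%:E <= sup_until X e w)%E}.
Proof.
apply: filterS2 (family_start hX x) (killing_time_ge0 x) => w Xw ew.
by rewrite -Xw; exact: running_sup_ge.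
Qed.

Lemma measurable_sup_until : measurable_fun setT (sup_until X e).
Proof.
apply: (@measurable_levy_running_sup _ _ id) => //; exact: killing_measurable he.
Qed.

Lemma expectation_sup_until (H : R -> R) x :
  {ae P x, forall w, sup_until X e w \is a fin_num} ->
  measurable_fun setT H -> (forall y, 0 <= H y) ->
  ('E_(P x)[fun w => H (fine (sup_until X e w))] =
    killed_expectation (ereal_ext H) x)%E.
Proof.
move=> Mfin mH H0; rewrite unlock /killed_expectation.
have mM := measurable_sup_until.
apply: ge0_ae_eq_integral => //.
- apply/measurable_EFinP; apply: (measurableT_comp mH).
  exact: measurableT_comp.
- by apply: (measurableT_comp (measurable_ereal_ext mH)).
- by move=> w _; rewrite lee_fin.
- by move=> w _; exact: ereal_ext_ge0.
by apply: filterS Mfin => w + _; case: sup_until.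
Qed.

Lemma killed_expectation_shift (H : \bar R -> \bar R) x :
  measurable_fun setT H -> (forall y, 0 <= H y)%E ->
  killed_expectation H x = killed_expectation (fun z => H (x%:E + z)%E) 0.
Proof.
move=> mH H0; rewrite killed_expectationE// [RHS]killed_expectationE//.
  by apply: eq_integral => z _; rewrite add0e.
by apply: (measurableT_comp mH); exact: emeasurable_funD.
Qed.

Lemma killed_expectation_fin c n x : 0 <= c ->
  {ae P 0, forall w, sup_until X e w \is a fin_num} ->
  (P 0).-integrable setT (fun w => (fine (sup_until X e w) ^+ n)%:E) ->
  (killed_expectation (ereal_ext (fun y => c * (1 + pos_part y) ^+ n)%R) x < +oo)%E.
Proof.
move=> c0 Mfin intM; set h := fun y => _.
have h0 y : 0 <= h y.
  by rewrite mulr_ge0// exprn_ge0// addr_ge0// le_max lexx orbT.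
have mh : measurable_fun setT h.
  apply: measurable_funM => //; apply: measurable_funX; apply: measurable_funD => //.
  by apply: nondecreasing_measurable => // y z yz; exact: le_max2.
rewrite killed_expectation_shift; [|exact: measurable_ereal_ext|].
  2: by move=> y; exact: ereal_ext_ge0.
have mM := measurable_sup_until.
(* The constant combines [1 + (x + m)^+ <= (1 + |x|) * (1 + m)] with [(1 + m)^n <= 2^n * (1 + m^n)];
   the latter is checked separately for m <= 1 and m > 1. *)
pose C := c * (1 + `|x|) ^+ n * 2 ^+ n.
have C0 : 0 <= C by rewrite !mulr_ge0// exprn_ge0// addr_ge0.
have powM m : 0 <= m -> h (x + m) <= C * (1 + m ^+ n).
  move=> m0; rewrite /h /C -!mulrA ler_wpM2l//.
  have p1 : 1 + pos_part (x + m) <= (1 + `|x|) * (1 + m).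
    have := ler_norm x; have := normr_ge0 x => x0 x1.
    have xm0 : 0 <= `|x| * m by rewrite mulr_ge0.
    by rewrite /pos_part maxEle; case: ifP => _; lra.
  apply: (@le_trans _ _ (((1 + `|x|) * (1 + m)) ^+ n)).
    rewrite lerXn2r// nnegrE; first by rewrite addr_ge0// le_max lexx orbT.
    by rewrite mulr_ge0// addr_ge0.
  rewrite exprMn ler_wpM2l ?exprn_ge0 ?addr_ge0//.
  have [m1|m1] := leP m 1.
    apply: (@le_trans _ _ (2 ^+ n)); first by rewrite lerXn2r ?nnegrE; lra.
    by rewrite ler_peMr ?exprn_ge0// lerDl exprn_ge0.
  apply: (@le_trans _ _ ((2 * m) ^+ n)); first by rewrite lerXn2r ?nnegrE; lra.
  by rewrite exprMn ler_wpM2l ?exprn_ge0// lerDr.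
have mMn : measurable_fun setT (fun w => fine (sup_until X e w) ^+ n).
  by apply: measurable_funX; exact: measurableT_comp.
have intC : (P 0).-integrable setT (fun w => (C * (1 + fine (sup_until X e w) ^+ n))%:E).
  under eq_fun do rewrite EFinM EFinD.
  apply: integrableZl => //; apply: integrableD => //.
  exact: finite_measure_integrable_cst.
have /integrableP[_] := intC; apply: le_lt_trans.
apply: ae_ge0_le_integral => //.
- by move=> w _; exact: ereal_ext_ge0.
- apply: (measurableT_comp (measurable_ereal_ext mh)).
  by apply: emeasurable_funD.
- apply: measurableT_comp => //; apply/measurable_EFinP.
  by apply: measurable_funM => //; exact: measurable_funD.
apply: filterS2 Mfin (sup_until_ge_start 0) => w.
case: sup_until => [m| |]//= _; rewrite lee_fin => m0 _.
by rewrite lee_fin; apply: le_trans (powM _ m0) (ler_norm _).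
Qed.

Lemma zero_rate_eventually_le0 x : r = 0 ->
  {ae P x, forall w, sup_until X e w \is a fin_num} ->
  (0 < P 0 [set w | (0 < sup_until X e w)%E])%E ->
  {ae P x, forall w, exists N : nat, forall s, N%:R <= s -> X s w <= 0}.
Proof.
move=> rE Mfin Mpos; have einf := killing_infinite he rE.
have ME w : sup_until X e w = running_sup (X ^~ w) +oo by rewrite -(einf w).
apply: levy_eventually_le0.
  by apply: filterS Mfin => w; rewrite ME.
apply: (lt_le_trans Mpos).
have mI : measurable_fun setT (fun w => incr_sup 0 w +oo%E).
  exact: (@measurable_incr_sup 0 _ _ id (fun=> +oo%E) (lexx 0)
    (@measurable_id _ _ setT) (measurable_cst _)).
have mI0 : measurable [set w | (0 < incr_sup 0 w +oo)%E].
  rewrite (_ : mkset _ = (fun w => incr_sup 0 w +oo) @^-1` `]0%E, +oo[%classic).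
    by rewrite -[X in measurable X]setTI; apply: mI => //; exact: emeasurable_itv.
  by apply/seteqP; split => w /=; rewrite in_itv/= andbT.
have mM0 : measurable [set w | (0 < sup_until X e w)%E].
  rewrite (_ : mkset _ = sup_until X e @^-1` `]0%E, +oo[%classic).
    rewrite -[X in measurable X]setTI.
    by apply: measurable_sup_until => //; exact: emeasurable_itv.
  by apply/seteqP; split => w /=; rewrite in_itv/= andbT.
(* Off the null set [N] the process starts at 0 and M is the supremum of its increments; adjoining
   [N] makes the inclusion hold everywhere. *)
have [N [mN N0 NP]] := family_start hX 0.
rewrite -(measureU0 mI0 mN N0); apply: le_measure; rewrite ?inE//.
  exact: measurableU.
move=> w /= Mw; have [X0|X0] := pselect (X 0 w = 0); last by right; exact: NP.
left; apply: (lt_le_trans Mw); rewrite ME /incr_sup le_eqVlt; apply/orP; left.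
by apply/eqP; congr running_sup; apply/funext => s; rewrite add0r X0 subr0.
Qed.

(** * The value function above the root and just below it *)

Section averaging.
Context (p Pn : {poly R}) (xs : R).
Hypotheses (Mfin : forall x, {ae P x, forall w, sup_until X e w \is a fin_num}).
Hypotheses (avg : forall x,
  ('E_(P x)[fun w => Pn.[fine (sup_until X e w)]] = p.[x]%:E)%E).
Hypotheses (xs0 : 0 < xs) (xsroot : root Pn xs).
Hypothesis Gmono : {homo truncated_poly Pn xs : y z / y <= z}.

Lemma truncated_poly_eq0 y : y <= xs -> truncated_poly Pn xs y = 0.
Proof.
by move=> yx; rewrite truncated_polyE// (max_idPr yx); exact/rootP.
Qed.

Lemma truncated_poly_ge0 y : 0 <= truncated_poly Pn xs y.
Proof.
have [yx|xy] := leP y xs; first by rewrite truncated_poly_eq0.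
by rewrite -(truncated_poly_eq0 (lexx xs)); apply: Gmono; exact: ltW.
Qed.

(** Started from y >= xs, M is almost surely at least xs, so the truncation is not felt. *)
Lemma averaging_value y : xs <= y ->
  killed_expectation (ereal_ext (truncated_poly Pn xs)) y = (p.[y])%:E.
Proof.
move=> xy; have mG := continuous_measurable_fun (continuous_truncated_poly xsroot).
have mP := continuous_measurable_fun (continuous_horner (p := Pn)).
have mM := measurable_sup_until.
rewrite -(expectation_sup_until (Mfin y) mG truncated_poly_ge0) -avg unlock.
apply: ae_eq_integral => //.
- by apply/measurable_EFinP; apply: (measurableT_comp mG); exact: measurableT_comp.
- by apply/measurable_EFinP; apply: (measurableT_comp mP); exact: measurableT_comp.
apply: filterS2 (Mfin y) (sup_until_ge_start y) => w.
case: sup_until => [m| |]//= _; rewrite lee_fin => ym _.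
by rewrite truncated_polyE// (max_idPl _)// (le_trans xy).
Qed.

(* Pn(M) need not be known to be integrable under P y: it suffices that its
   negative part is at most eps and that its integral is finite. *)
Lemma averaging_value_le eps : 0 < eps -> exists2 eta, 0 < eta & forall y, xs - eta <= y ->
  (killed_expectation (ereal_ext (truncated_poly Pn xs)) y <=
   (poly_payoff p y + eps)%:E)%E.
Proof.
move=> eps0; have mG := continuous_measurable_fun (continuous_truncated_poly xsroot).
have mP := continuous_measurable_fun (continuous_horner (p := Pn)).
have mM := measurable_sup_until.
have /cvgrPdist_lt/(_ eps eps0) : Pn.[y] @[y --> xs] --> Pn.[xs].
  exact: continuous_horner.
move=> /nbhs_ballP[rho /= rho0 rhoP].
(* The bound by [rho / 2] keeps y within the range of continuity at xs; the bound by xs keeps y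
   nonnegative, so that the payoff at y involves [p.[y]] itself. *)
pose eta := Num.min (rho / 2) xs.
have eta0 : 0 < eta by rewrite lt_min xs0 divr_gt0.
have etaxs : eta <= xs by rewrite ge_min lexx orbT.
have etarho : eta < rho.
  by apply: (@le_lt_trans _ _ (rho / 2)); [rewrite ge_min lexx|lra].
exists eta => // y xy; have y0 : 0 <= y by lra.
pose f w := (Pn.[fine (sup_until X e w)])%:E.
have mf : measurable_fun setT f.
  by apply/measurable_EFinP; apply: (measurableT_comp mP); exact: measurableT_comp.
have GM m : y <= m -> truncated_poly Pn xs m <= Num.max Pn.[m] 0 /\ - Pn.[m] <= eps.
  move=> ym; have [xm|mx] := leP xs m.
    have := truncated_poly_ge0 m; rewrite truncated_polyE// (max_idPl xm) => P0.
    by rewrite (max_idPl P0); split => //; lra.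
  rewrite truncated_poly_eq0 ?le_max ?lexx ?orbT; last exact: ltW.
  split => //; have /rhoP : ball xs rho m by rewrite /ball/= gtr0_norm ?subr_gt0//; lra.
  rewrite /= (rootP xsroot) sub0r => H; apply/ltW; apply: le_lt_trans H.
  exact: ler_norm.
have : (\int[P y]_w f w = p.[y]%:E)%E by rewrite -avg unlock.
rewrite integralE => If.
have neg_le : (\int[P y]_w f^\- w <= eps%:E)%E.
  rewrite -[leRHS]mule1 -[X in (_ * X)%E](probability_setT (P y)) -integral_cst//.
  apply: ae_ge0_le_integral => //.
  - exact: measurable_funeneg.
  - by move=> w _; rewrite lee_fin ltW.
  apply: filterS2 (Mfin y) (sup_until_ge_start y) => w Mw yM _.
  rewrite funenegE /f; move: Mw yM; case: sup_until => [m| |]//= _; rewrite lee_fin => ym.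
  by rewrite -EFin_max lee_fin ge_max (ltW eps0) andbT; case: (GM _ ym).
have pos_ge : (killed_expectation (ereal_ext (truncated_poly Pn xs)) y <=
    \int[P y]_w f^\+ w)%E.
  rewrite -(expectation_sup_until (Mfin y) mG truncated_poly_ge0) unlock.
  apply: ae_ge0_le_integral => //.
  - by move=> w _; rewrite lee_fin truncated_poly_ge0.
  - by apply/measurable_EFinP; apply: (measurableT_comp mG); exact: measurableT_comp.
  - exact: measurable_funepos.
  apply: filterS2 (Mfin y) (sup_until_ge_start y) => w Mw yM _.
  rewrite funeposE /f; move: Mw yM; case: sup_until => [m| |]//= _; rewrite lee_fin => ym.
  by rewrite -EFin_max lee_fin; case: (GM _ ym).
apply: (le_trans pos_ge).
have negf : (\int[P y]_w f^\- w)%E \is a fin_num.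
  by rewrite ge0_fin_numE ?(le_lt_trans neg_le) ?ltry//; exact: integral_ge0.
(* Since the negative part has a finite integral, the integral of the positive part is [p.[y]] plus
   it, hence at most [p.[y] + eps]. *)
rewrite -(subeK (\int[P y]_w f^\+ w)%E negf) If EFinD; apply: leeD => //.
by rewrite lee_fin /poly_payoff (pos_part_id y0) le_max lexx.
Qed.

End averaging.
End killed_law.
End levy.

(** * Solution of the optimal stopping problem *)

Theorem theorem2 (R : realType) (d : measure_display) (T : measurableType d)
    (P : R -> probability T R) (F : R -> set (set T)) (X : R -> T -> R)
    (r : R) (e : T -> \bar R) (n : nat) (p Pn : {poly R}) (xs : R) :
  levy_family P F X ->
  0 <= r ->
  killing_time P X r e ->
  let M := sup_until X e in
  (forall x, {ae P x, forall w, M w \is a fin_num}) ->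
  (forall x, (0 < P x [set w | (x%:E < M w)%E])%E) ->
  (1 <= n)%N ->
  p \is monic -> size p = n.+1 -> p.[0] = 0 ->
  (forall k, (1 <= k <= n)%N ->
    (P 0).-integrable setT (fun w => (fine (M w) ^+ k)%:E)) ->
  averaging_poly P M n p Pn ->
  largest_positive_root Pn xs ->
  let g := poly_payoff p in
  let G := truncated_poly Pn xs in
  let V x := 'E_(P x)[fun w => G (fine (M w))]%E in
  let taus := hitting_time X xs in
  {homo G : x y / x <= y} ->
  (forall x, x <= xs -> ((g x)%:E <= V x)%E) ->
  stopping_time F taus /\
  (forall x,
    V x = ereal_sup [set (\int[P x]_w discounted_payoff r g X tau w)%E
                      | tau in stopping_time F] /\
    V x = (\int[P x]_w discounted_payoff r g X taus w)%E).
Proof.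
move=> hX r0 he M Mfin Mpos n1 pmonic sp p0 intM avg [xs0 xsroot xsmax] g G V taus Gmono gV.
have avgE x : ('E_(P x)[fun w => Pn.[fine (M w)]] = p.[x]%:E)%E by case: avg.
have staus : stopping_time F taus by exact: hitting_time_stopping hX xs.
split=> // x.
have Gcont : continuous G by exact: continuous_truncated_poly.
have G0 y : 0 <= G y by exact: truncated_poly_ge0.
have Gxs y : y <= xs -> G y = 0 by move=> ?; exact: truncated_poly_eq0.
have mG : measurable_fun setT G by exact: continuous_measurable_fun.
have VE y : V y = killed_expectation P X e (ereal_ext G) y.
  exact: (expectation_sup_until hX he (Mfin y)).
pose c := \sum_(i < n.+1) `|p`_i|.
have c0 : 0 <= c by exact: sumr_ge0.
pose h y := c * (1 + pos_part y) ^+ n.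
have g0 y : 0 <= g y by exact: pos_part_ge0.
have gcont : continuous g by exact: continuous_poly_payoff.
have gneg y : y <= 0 -> g y = 0.
  by move=> y0; rewrite /g /poly_payoff (pos_part0 y0) p0 pos_part0.
have gh y : g y <= h y by apply: poly_payoff_le; rewrite sp.
have hmono : {homo h : y z / y <= z}.
  move=> y z yz; rewrite ler_wpM2l// lerXn2r ?nnegrE ?addr_ge0 ?pos_part_ge0//.
  by rewrite lerD2l; exact: le_max2.
have hneg y : y <= 0 -> h y = h 0.
  by move=> y0; rewrite /h !pos_part0.
have hfin y : (killed_expectation P X e (ereal_ext h) y < +oo)%E.
  apply: (killed_expectation_fin hX he) => //.
  by apply: intM; rewrite n1 leqnn.
have zero_rate : r = 0 -> forall y,
    {ae P y, forall w, exists N : nat, forall s, N%:R <= s -> X s w <= 0}.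
  by move=> rE y; exact: (zero_rate_eventually_le0 hX he).
(* Above xs the value is [p.[y]]; being the expectation of a nonnegative variable it is nonnegative,
   so taking the positive part in g changes nothing. *)
have gleV y : ((g y)%:E <= killed_expectation P X e (ereal_ext G) y)%E.
  rewrite -VE; have [|xy] := leP y xs; first exact: gV.
  have Vy : V y = (p.[y])%:E.
    rewrite VE; apply: (averaging_value hX he r0) => //; exact: ltW.
  have V0 : (0 <= V y)%E by rewrite VE; apply: integral_ge0 => w _; exact: ereal_ext_ge0.
  move: V0; rewrite Vy !lee_fin => V0.
  by rewrite /g /poly_payoff (pos_part_id (ltW (lt_trans xs0 xy))) pos_part_id.
have upper tau : stopping_time F tau ->
    (\int[P x]_w discounted_payoff r g X tau w <= V x)%E.
  move=> stau; rewrite VE.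
  rewrite (integral_discounted_payoff hX he r0 g0 gcont gneg gh hmono hneg hfin zero_rate)//.
  exact: (stopped_payoff_le hX he r0 g0 gcont gh hmono hneg hfin xs0
    Gmono Gxs Gcont).
have lower : (V x <= \int[P x]_w discounted_payoff r g X taus w)%E.
  rewrite (integral_discounted_payoff hX he r0 g0 gcont gneg gh hmono hneg hfin zero_rate)//.
  rewrite /V unlock.
  apply: (stopped_payoff_hitting_ge hX he r0 g0 gcont gh hmono hneg hfin xs0
    Gmono Gxs Gcont) => eps eps0.
  exact: (averaging_value_le hX he r0 Mfin avgE).
split.
  apply/eqP; rewrite eq_le; apply/andP; split.
    by apply: (le_trans lower); apply: ereal_sup_ubound; exists taus.
  by apply: ge_ereal_sup => _ [tau stau <-]; exact: upper.
by apply/eqP; rewrite eq_le lower upper.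
Qed.
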